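(* Let $q$ be a prime power, let $n_0,n_1,\dots$ be a factor sequence, and let $M(\mathbb{F}_q)$ be the associated metric $\mathbb{F}_q$-algebra. Then $M(\mathbb{F}_q)$ is the Fraïssé limit of the class $\mathcal{K}(\mathbb{F}_q)=\{M_n(\mathbb{F}_q): n\ge 1\}$; that is, $M(\mathbb{F}_q)$ (which is by construction a $\mathcal{K}(\mathbb{F}_q)$-structure) satisfies: (1) ($\mathcal{K}(\mathbb{F}_q)$-universality) for every $n\ge 1$ there is an embedding $M_n(\mathbb{F}_q)\hookrightarrow M(\mathbb{F}_q)$; (2) (approximate homogeneity) for every $n\ge 1$, all embeddings $\phi,\psi:M_n(\mathbb{F}_q)\hookrightarrow M(\mathbb{F}_q)$ and every $\varepsilon>0$, there is an automorphism $\beta$ of $M(\mathbb{F}_q)$ such that $d(\beta\circ\phi,\psi)<\varepsilon$.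
   Context: Each $M_n(\mathbb{F}_q)$ carries the metric $d(x,y)=\frac{\mathrm{rank}(x-y)}{n}$. For $m\mid n$, $\iota_{n,m}:M_m(\mathbb{F}_q)\to M_n(\mathbb{F}_q)$ is the isometric unital embedding $x\mapsto x\otimes 1_{n/m}$. A factor sequence is a sequence $n_0,n_1,\dots$ of positive integers with $n_k\mid n_{k+1}$ for all $k$ and $n_k\to\infty$. Given a factor sequence, $M_0(\mathbb{F}_q)$ is the direct limit of $M_{n_0}(\mathbb{F}_q)\to M_{n_1}(\mathbb{F}_q)\to\cdots$ along the maps $\iota_{n_{k+1},n_k}$, with the induced metric, and $M(\mathbb{F}_q)$ is the metric completion of $M_0(\mathbb{F}_q)$, which is again a unital $\mathbb{F}_q$-algebra. A $\mathcal{K}(\mathbb{F}_q)$-structure is an algebra arising as $M(\mathbb{F}_q)$ for some factor sequence. An embedding is a unital isometric $\mathbb{F}_q$-algebra homomorphism; an automorphism is a surjective embedding of an algebra to itself. For maps $f,g:A\to B$ into a metric structure, $d(f,g)=\sup_{x\in A}d(f(x),g(x))$. *)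

(* Defs.v *)
From HB Require Import structures.
From mathcomp Require Import all_boot all_order all_algebra.
From mathcomp Require Import generic_quotient.
From mathcomp Require Import all_classical all_reals topology.
From mathcomp Require Import ring.
From mathcomp.real_closed Require Import mxtens.

Set Implicit Arguments.
Unset Strict Implicit.
Unset Printing Implicit Defensive.

Import Order.TTheory GRing.Theory Num.Theory.

Local Open Scope classical_set_scope.
Local Open Scope quotient_scope.
Local Open Scope ring_scope.

(* Algebras over a field with a metric for which translations are isometries
   and multiplications are contractions; these compatibilities are what makes
   the operations extend to the metric completion. *)
HB.mixin Record hasContractiveOps (F : fieldType) (R : realType) (A : Type)
    of GRing.Algebra F A & Metric R A := {
  mdistDr : forall z x y : A, mdist (x + z) (y + z) = mdist x y;
  mdistMl : forall z x y : A, mdist (z * x) (z * y) <= mdist x y;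
  mdistMr : forall z x y : A, mdist (x * z) (y * z) <= mdist x y;
  mdistZ : forall (a : F) (x y : A), mdist (a *: x) (a *: y) <= mdist x y
}.

#[short(type="metricAlgType")]
HB.structure Definition MetricAlgebra (F : fieldType) (R : realType) :=
  { A of GRing.Algebra F A & Metric R A & hasContractiveOps F R A }.

(* Loaded only now: it joins lmodType and topological structures over one and
   the same numDomainType, whereas here F and R are unrelated, and HB rejects
   the structure above in its presence. *)
From mathcomp Require Import ereal normedtype sequences.
Import numFieldNormedType.Exports.

Section RankDistance.
Context {F : fieldType} {R : realType}.
Implicit Type n : nat.

Definition rkdist n (x y : 'M[F]_n) : R := (\rank (x - y))%:R / n%:R.

Lemma rkdistxx n (x : 'M[F]_n) : rkdist x x = 0.
Proof. by rewrite /rkdist subrr mxrank0 mul0r. Qed.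

Lemma rkdist_pos n (x y : 'M[F]_n) : rkdist x y = 0 -> x = y.
Proof.
case: n x y => [|n] x y; first by rewrite [x]flatmx0 [y]flatmx0.
move/eqP; rewrite /rkdist mulf_eq0 invr_eq0 !pnatr_eq0 orbF mxrank_eq0.
by rewrite subr_eq0 => /eqP.
Qed.

Lemma rkdist_sym n (x y : 'M[F]_n) : rkdist x y = rkdist y x.
Proof. by rewrite /rkdist -opprB mxrank_opp. Qed.

Lemma rkdist_triangle n (y x z : 'M[F]_n) :
  rkdist x z <= rkdist x y + rkdist y z.
Proof.
rewrite /rkdist -mulrDl ler_wpM2r ?invr_ge0// -natrD ler_nat.
by rewrite (_ : x - z = (x - y) + (y - z)) ?mxrank_add// addrA subrK.
Qed.

Lemma rkdistDr n (z x y : 'M[F]_n) : rkdist (x + z) (y + z) = rkdist x y.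
Proof. by rewrite /rkdist opprD addrACA subrr addr0. Qed.

Lemma rkdistMl n (z x y : 'M[F]_n) : rkdist (z *m x) (z *m y) <= rkdist x y.
Proof.
by rewrite /rkdist -mulmxBr ler_wpM2r ?invr_ge0// ler_nat mxrankM_maxr.
Qed.

Lemma rkdistMr n (z x y : 'M[F]_n) : rkdist (x *m z) (y *m z) <= rkdist x y.
Proof.
by rewrite /rkdist -mulmxBl ler_wpM2r ?invr_ge0// ler_nat mxrankM_maxl.
Qed.

Lemma rkdistZ n (a : F) (x y : 'M[F]_n) :
  rkdist (a *: x) (a *: y) <= rkdist x y.
Proof. by rewrite -!mul_scalar_mx rkdistMl. Qed.

End RankDistance.

Section RankMatrices.
Variables (F : fieldType) (R : realType).

(* M_(n+1)(F) with the normalized rank metric. The vacuous mention of R makes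
   the codomain of the metric inferable from the type. *)
Definition rkmx (n : nat) : Type := let _ := R in 'M[F]_n.+1.

HB.instance Definition _ n := GRing.Algebra.on (rkmx n).
HB.instance Definition _ n := isMetric.Build R (rkmx n)
  (@rkdistxx F R n.+1) (@rkdist_pos F R n.+1) (@rkdist_sym F R n.+1)
  (@rkdist_triangle F R n.+1).
HB.instance Definition _ n := hasContractiveOps.Build F R (rkmx n)
  (@rkdistDr F R n.+1) (@rkdistMl F R n.+1) (@rkdistMr F R n.+1)
  (@rkdistZ F R n.+1).

End RankMatrices.

Section Amplification.
Variable F : fieldType.

(* x |-> x (x) 1_(n/m). The product has size m * (n %/ m), which equals n when
   m %| n; conform_mx then is the corresponding cast (and 0 otherwise). *)
Definition ampl (m n : nat) (x : 'M[F]_m) : 'M[F]_n :=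
  conform_mx 0 (tensmx x (1%:M : 'M[F]_(n %/ m))).

Lemma amplE m d (x : 'M[F]_m) : (0 < m)%N ->
  ampl (m * d) x = tensmx x (1%:M : 'M[F]_d).
Proof.
move=> m0; rewrite /ampl; move: (m * d %/ m)%N (mulKn d m0) => d' ->.
exact: conform_mx_id.
Qed.

Lemma tensmx11 m d : tensmx (1%:M : 'M[F]_m) (1%:M : 'M[F]_d) = 1%:M.
Proof.
apply/matrixP => i j; case: (mxtens_indexP i) => i1 i2.
case: (mxtens_indexP j) => j1 j2.
rewrite tensmxE !mxE (can_eq (@mxtens_indexK _ _)) xpair_eqE -natrM.
by case: eqP; case: eqP.
Qed.

Lemma mxrank_tensmx1 m d (x : 'M[F]_m) :
  \rank (tensmx x (1%:M : 'M[F]_d)) = (\rank x * d)%N.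
Proof.
apply/eqP; rewrite eqn_leq; apply/andP; split.
  rewrite -{1}(mulmx_base x) -{1}(mulmx1 (1%:M : 'M[F]_d)) -tensmx_mul.
  by apply: leq_trans (mxrankM_maxl _ _) _; rewrite rank_leq_col.
have /row_fullP[L Lx] : row_full (col_base x) by apply: col_base_full.
have /row_freeP[U xU] : row_free (row_base x) by apply: row_base_free.
have E : tensmx L (1%:M : 'M[F]_d) *m tensmx x 1%:M *m tensmx U 1%:M = 1%:M.
  have -> : 1%:M = tensmx (row_base x *m U) (1%:M : 'M[F]_d).
    by rewrite xU tensmx11.
  have <- : L *m x = row_base x.
    by rewrite -[RHS]mul1mx -Lx -mulmxA mulmx_base.
  by rewrite !tensmx_mul !mulmx1.
rewrite -{1}(mxrank1 F (\rank x * d)) -E.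
by apply: leq_trans (mxrankM_maxl _ _) _; apply: mxrankM_maxr.
Qed.

Lemma conform_mx0B p n (x y : 'M[F]_p) :
  conform_mx (0 : 'M[F]_n) (x - y) = conform_mx 0 x - conform_mx 0 y.
Proof.
case: (eqVneq p n) => [e|ne]; first by subst p; rewrite !conform_mx_id.
by rewrite !nonconform_mx ?ne// subrr.
Qed.

Lemma conform_mx0Z p n a (x : 'M[F]_p) :
  conform_mx (0 : 'M[F]_n) (a *: x) = a *: conform_mx 0 x.
Proof.
case: (eqVneq p n) => [e|ne]; first by subst p; rewrite !conform_mx_id.
by rewrite !nonconform_mx ?ne// scaler0.
Qed.

Lemma amplB m n : {morph @ampl m n : x y / x - y}.
Proof.
move=> x y; rewrite /ampl.
have -> : tensmx (x - y) (1%:M : 'M[F]_(n %/ m)) =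
          tensmx x 1%:M - tensmx y 1%:M.
  by apply/matrixP => i j; rewrite !mxE mulrBl.
exact: conform_mx0B.
Qed.

Lemma ampl0 m n : @ampl m n 0 = 0.
Proof. by rewrite -(subrr 0) amplB subrr. Qed.

Lemma amplN m n : {morph @ampl m n : x / - x}.
Proof. by move=> x; rewrite -sub0r amplB ampl0 sub0r. Qed.

Lemma amplD m n : {morph @ampl m n : x y / x + y}.
Proof. by move=> x y; rewrite -[y]opprK amplB !amplN. Qed.

Lemma amplZ m n a : {morph @ampl m n : x / a *: x}.
Proof.
move=> x; rewrite /ampl.
have -> : tensmx (a *: x) (1%:M : 'M[F]_(n %/ m)) = a *: tensmx x 1%:M.
  by apply/matrixP => i j; rewrite !mxE mulrA.
exact: conform_mx0Z.
Qed.

Lemma amplM m n : (0 < n)%N -> (m %| n)%N ->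
  {morph @ampl m n : x y / x *m y}.
Proof.
move=> n0 mn x y; have m0 := dvdn_gt0 n0 mn.
rewrite -(divnK mn) mulnC !amplE// tensmx_mul mulmx1 //.
Qed.

Lemma ampl1 m n : (0 < n)%N -> (m %| n)%N -> @ampl m n 1%:M = 1%:M.
Proof.
move=> n0 mn; have m0 := dvdn_gt0 n0 mn.
by rewrite -(divnK mn) mulnC !amplE// tensmx11.
Qed.

Lemma ampl_entry m n (x : 'M[F]_m) (i j : 'I_n) (i1 j1 : 'I_m) :
  (0 < n)%N -> (m %| n)%N ->
  val i1 = (i %/ (n %/ m))%N -> val j1 = (j %/ (n %/ m))%N ->
  ampl n x i j = x i1 j1 * ((i %% (n %/ m))%N == (j %% (n %/ m))%N)%:R.
Proof.
move=> n0 mn; have m0 := dvdn_gt0 n0 mn.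
move: i j; rewrite -(divnK mn) mulnC; move: (n %/ m)%N => d i j.
rewrite mulKn// => ei ej; rewrite amplE// !mxE -val_eqE /=.
by congr (x _ _ * _); apply: val_inj; rewrite /= ?ei ?ej.
Qed.

Lemma ampl_id m (x : 'M[F]_m) : ampl m x = x.
Proof.
case: m x => [|m] x; first by rewrite [x]flatmx0 [LHS]flatmx0.
apply/matrixP => i j; rewrite (@ampl_entry _ _ x i j i j)//.
- by rewrite divnn/= !modn1 eqxx mulr1.
- by rewrite divnn/= divn1.
- by rewrite divnn/= divn1.
Qed.

Lemma ampl_comp m n p (x : 'M[F]_m) : (0 < p)%N ->
  (m %| n)%N -> (n %| p)%N -> ampl p (ampl n x) = ampl p x.
Proof.
move=> p0 mn np; have n0 := dvdn_gt0 p0 np; have m0 := dvdn_gt0 n0 mn.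
have mp := dvdn_trans mn np.
have [d nE] : exists d, n = (m * d)%N by exists (n %/ m)%N; rewrite mulnC divnK.
have [e pE] : exists e, p = (n * e)%N by exists (p %/ n)%N; rewrite mulnC divnK.
have d0 : (0 < d)%N by move: n0; rewrite nE muln_gt0 => /andP[].
have e0 : (0 < e)%N by move: p0; rewrite pE muln_gt0 => /andP[].
have pn : (p %/ n = e)%N by rewrite pE mulKn.
have nm : (n %/ m = d)%N by rewrite nE mulKn.
have pm : (p %/ m = d * e)%N by rewrite pE nE -mulnA mulKn.
have lt1 (i : 'I_p) : (i %/ e < n)%N by rewrite ltn_divLR// -pE.
have lt2 (i : 'I_p) : (i %/ (d * e) < m)%N.
  by rewrite ltn_divLR ?muln_gt0 ?d0// mulnA -nE -pE.
apply/matrixP => i j.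
rewrite (@ampl_entry n p _ i j (Ordinal (lt1 i)) (Ordinal (lt1 j))) ?pn//.
rewrite (@ampl_entry m n _ _ _ (Ordinal (lt2 i)) (Ordinal (lt2 j))) ?nm//=;
  try by rewrite mulnC divnMA.
rewrite (@ampl_entry m p _ i j (Ordinal (lt2 i)) (Ordinal (lt2 j))) ?pm//.
rewrite -mulrA -natrM mulnb; congr (_ * _%:R); congr (nat_of_bool _).
have modE k : (k %% (d * e) = (k %/ e) %% d * e + k %% e)%N.
  by rewrite {1}(divn_eq (k %% (d * e))%N e) -modn_divl modn_dvdm ?dvdn_mull.
apply/andP/eqP => [[/eqP h1 /eqP h2]|h]; first by rewrite !modE h1 h2.
split; apply/eqP; first by rewrite !modn_divl h.
by rewrite -(modn_dvdm i (dvdn_mull d (dvdnn e))) h modn_dvdm ?dvdn_mull.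
Qed.

Lemma rkdist_ampl (R : realType) m n (x y : 'M[F]_m) :
  (0 < n)%N -> (m %| n)%N ->
  rkdist (ampl n x) (ampl n y) = rkdist x y :> R.
Proof.
move=> n0 mn; have m0 := dvdn_gt0 n0 mn; rewrite /rkdist -amplB.
move: n0; rewrite -(divnK mn) mulnC; move: (n %/ m)%N => d.
rewrite muln_gt0 m0/= => d0; rewrite amplE// mxrank_tensmx1 !natrM.
by rewrite -mulf_div divff ?mulr1// pnatr_eq0 -lt0n.
Qed.

Lemma ampl_inj m n : (0 < n)%N -> (m %| n)%N -> injective (@ampl m n).
Proof.
move=> n0 mn x y /eqP; have m0 := dvdn_gt0 n0 mn.
rewrite -subr_eq0 -amplB -mxrank_eq0.
move: n0; rewrite -(divnK mn) mulnC; move: (n %/ m)%N => d.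
rewrite muln_gt0 m0/= => d0; rewrite amplE// mxrank_tensmx1 muln_eq0.
by rewrite (gtn_eqF d0) orbF mxrank_eq0 subr_eq0 => /eqP.
Qed.

End Amplification.

Record factorSeq := FactorSeq {
  fseq :> nat -> nat;
  fseq_gt0 : forall k, (0 < fseq k)%N;
  fseq_dvd : forall k, (fseq k %| fseq k.+1)%N;
  fseq_cvg : fseq @ \oo --> \oo
}.

Lemma fseq_dvdn (s : factorSeq) k l : (k <= l)%N -> (s k %| s l)%N.
Proof.
move=> /subnKC <-; elim: (l - k)%N => [|d IH]; first by rewrite addn0.
by rewrite addnS; apply: dvdn_trans IH _; apply: fseq_dvd.
Qed.

Section DirectLimit.
Variables (F : fieldType) (R : realType) (s : factorSeq).

Local Notation T := {k : nat & 'M[F]_(s k)}.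
Implicit Types (u v w : T) (k l m p : nat).

Local Notation mk := (@existT nat (fun k => 'M[F]_(s k))).

(* Representatives (k, x), x a matrix of size s k, of elements of the direct
   limit are compared and combined after amplification to a common level. *)
Definition at_level m u : 'M[F]_(s m) := ampl (s m) (tagged u).

Lemma at_level_ampl m p u : (tag u <= m)%N -> (m <= p)%N ->
  ampl (s p) (at_level m u) = at_level p u.
Proof.
by move=> um mp; rewrite /at_level ampl_comp ?fseq_gt0 ?fseq_dvdn.
Qed.

Lemma at_level_inj m p u v :
  (tag u <= m)%N -> (tag v <= m)%N -> (m <= p)%N ->
  at_level p u = at_level p v -> at_level m u = at_level m v.
Proof.
move=> um vm mp; rewrite -(at_level_ampl um mp) -(at_level_ampl vm mp).
by apply: ampl_inj; rewrite ?fseq_gt0 ?fseq_dvdn.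
Qed.

Definition dl_eq u v : bool :=
  `[< exists m, [/\ (tag u <= m)%N, (tag v <= m)%N
                  & at_level m u = at_level m v] >].

Lemma dl_eqP m u v : (tag u <= m)%N -> (tag v <= m)%N ->
  reflect (at_level m u = at_level m v) (dl_eq u v).
Proof.
move=> um vm; apply: (iffP (asboolP _)) => [[p [up vp e]]|e]; last by exists m.
apply: (@at_level_inj m (maxn m p)); rewrite ?leq_maxl//.
by rewrite -(at_level_ampl up (leq_maxr m p)) e at_level_ampl// leq_maxr.
Qed.

Lemma dl_eq_refl : reflexive dl_eq.
Proof. by move=> u; apply/(dl_eqP (leqnn _) (leqnn _)). Qed.

Lemma dl_eq_sym : symmetric dl_eq.
Proof.
by move=> u v; apply/asboolP/asboolP => -[m [um vm e]]; exists m.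
Qed.

Lemma dl_eq_trans : transitive dl_eq.
Proof.
move=> v u w uv vw; pose m := maxn (tag u) (maxn (tag v) (tag w)).
have um : (tag u <= m)%N by rewrite leq_maxl.
have vm : (tag v <= m)%N by rewrite /m maxnCA leq_maxl.
have wm : (tag w <= m)%N by rewrite /m maxnA leq_maxr.
apply/(dl_eqP um wm); move/(dl_eqP um vm): uv => ->.
by move/(dl_eqP vm wm): vw.
Qed.

Canonical dl_equiv := EquivRel dl_eq dl_eq_refl dl_eq_sym dl_eq_trans.

Definition dlim : Type := let _ := R in {eq_quot dl_equiv}.
HB.instance Definition _ := Choice.on dlim.
HB.instance Definition _ := EqQuotient.on dlim.

Definition dlin k (x : 'M[F]_(s k)) : dlim := \pi_(dlim) (mk _ x).
Definition dlev (a b : dlim) : nat := maxn (tag (repr a)) (tag (repr b)).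

Lemma dlin_inj k : injective (@dlin k).
Proof.
move=> x y /eqP; rewrite /dlin eqquotE => /(@dl_eqP k (mk _ x) (mk _ y)).
by rewrite /at_level /= !ampl_id; apply.
Qed.

Lemma dlin_ampl k l (x : 'M[F]_(s k)) : (k <= l)%N ->
  dlin (ampl (s l) x) = dlin x.
Proof.
move=> kl; apply/eqP; rewrite /dlin eqquotE.
by apply/(@dl_eqP l (mk l _) (mk _ x)); rewrite // /at_level/= ampl_id.
Qed.

Lemma dlin_at m a : (tag (repr a) <= m)%N -> dlin (at_level m (repr a)) = a.
Proof.
move=> am; rewrite /at_level dlin_ampl// -[RHS]reprK /dlin.
by case: (repr a).
Qed.

Lemma at_dlin k p (x : 'M[F]_(s k)) :
  (k <= p)%N -> (tag (repr (dlin x)) <= p)%N ->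
  at_level p (repr (dlin x)) = ampl (s p) x.
Proof. by move=> kp xp; apply: dlin_inj; rewrite dlin_at// dlin_ampl. Qed.

Lemma dlinW2 (P : dlim -> dlim -> Prop) :
  (forall m (x y : 'M[F]_(s m)), P (dlin x) (dlin y)) -> forall a b, P a b.
Proof.
move=> H a b; have := H _ (at_level (dlev a b) (repr a))
  (at_level (dlev a b) (repr b)).
by rewrite !dlin_at ?leq_maxl ?leq_maxr.
Qed.

Lemma dlinW3 (P : dlim -> dlim -> dlim -> Prop) :
  (forall m (x y z : 'M[F]_(s m)), P (dlin x) (dlin y) (dlin z)) ->
  forall a b c, P a b c.
Proof.
move=> H a b c; pose m := maxn (dlev a b) (tag (repr c)).
have := H _ (at_level m (repr a)) (at_level m (repr b)) (at_level m (repr c)).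
by rewrite !dlin_at ?leq_max ?leqnn ?orbT.
Qed.

Lemma dlinW (P : dlim -> Prop) :
  (forall m (x : 'M[F]_(s m)), P (dlin x)) -> forall a, P a.
Proof. by move=> H a; apply: (dlinW2 (P := fun a _ => P a)) a. Qed.

Definition dl_lift2 (f : forall n, 'M[F]_n -> 'M[F]_n -> 'M[F]_n) (a b : dlim)
  : dlim :=
  dlin (f _ (at_level (dlev a b) (repr a)) (at_level (dlev a b) (repr b))).

Lemma dl_lift2E (f : forall n, 'M[F]_n -> 'M[F]_n -> 'M[F]_n) :
  (forall m n, (0 < n)%N -> (m %| n)%N -> {morph @ampl F m n : x y / f _ x y}) ->
  forall k (x y : 'M[F]_(s k)),
    dl_lift2 f (dlin x) (dlin y) = dlin (f _ x y).
Proof.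
move=> fM k x y; rewrite /dl_lift2; set L := dlev _ _; pose p := maxn k L.
have [kp Lp] : (k <= p)%N /\ (L <= p)%N by rewrite leq_maxl leq_maxr.
have xL : (tag (repr (dlin x)) <= L)%N by rewrite leq_maxl.
have yL : (tag (repr (dlin y)) <= L)%N by rewrite leq_maxr.
rewrite -(dlin_ampl _ Lp) fM ?fseq_gt0 ?fseq_dvdn// !at_level_ampl//.
rewrite !at_dlin ?(leq_trans xL) ?(leq_trans yL)// -fM ?fseq_gt0 ?fseq_dvdn//.
exact: dlin_ampl.
Qed.

Definition dl_lift1 (f : forall n, 'M[F]_n -> 'M[F]_n) (a : dlim) : dlim :=
  dlin (f _ (tagged (repr a))).

Lemma dl_lift1E (f : forall n, 'M[F]_n -> 'M[F]_n) :
  (forall m n, {morph @ampl F m n : x / f _ x}) ->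
  forall k (x : 'M[F]_(s k)), dl_lift1 f (dlin x) = dlin (f _ x).
Proof.
move=> fM k x; rewrite /dl_lift1; set u := repr _; pose p := maxn k (tag u).
have [kp up] : (k <= p)%N /\ (tag u <= p)%N by rewrite leq_maxl leq_maxr.
rewrite -(dlin_ampl _ up) fM -/(at_level p u) at_dlin// -fM.
exact: dlin_ampl.
Qed.

Definition dl_add := dl_lift2 (fun n x y => x + y).
Definition dl_mul := dl_lift2 (fun n x y => x *m y).
Definition dl_opp := dl_lift1 (fun n x => - x).
Definition dl_scale (c : F) := dl_lift1 (fun n x => c *: x).
Definition dl_zero : dlim := @dlin 0 0.
Definition dl_one : dlim := @dlin 0 1%:M.

Lemma dl_addE k (x y : 'M[F]_(s k)) : dl_add (dlin x) (dlin y) = dlin (x + y).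
Proof. by apply: dl_lift2E => m n _ _; apply: amplD. Qed.

Lemma dl_mulE k (x y : 'M[F]_(s k)) : dl_mul (dlin x) (dlin y) = dlin (x *m y).
Proof. by apply: dl_lift2E => m n; apply: amplM. Qed.

Lemma dl_oppE k (x : 'M[F]_(s k)) : dl_opp (dlin x) = dlin (- x).
Proof. by apply: dl_lift1E => m n; apply: amplN. Qed.

Lemma dl_scaleE c k (x : 'M[F]_(s k)) : dl_scale c (dlin x) = dlin (c *: x).
Proof. by apply: dl_lift1E => m n; apply: amplZ. Qed.

Lemma dl_zeroE k : dl_zero = @dlin k 0.
Proof. by rewrite -(@ampl0 F (s 0) (s k)) dlin_ampl. Qed.

Lemma dl_oneE k : dl_one = @dlin k 1%:M.
Proof.
by rewrite -(@ampl1 F (s 0) (s k)) ?fseq_gt0 ?fseq_dvdn// dlin_ampl.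
Qed.

Lemma dl_addA : associative dl_add.
Proof. by apply: dlinW3 => m x y z; rewrite !dl_addE addrA. Qed.
Lemma dl_addC : commutative dl_add.
Proof. by apply: dlinW2 => m x y; rewrite !dl_addE addrC. Qed.
Lemma dl_add0 : left_id dl_zero dl_add.
Proof. by apply: dlinW => m x; rewrite (dl_zeroE m) dl_addE add0r. Qed.
Lemma dl_addN : left_inverse dl_zero dl_opp dl_add.
Proof. by apply: dlinW => m x; rewrite (dl_zeroE m) dl_oppE dl_addE addNr. Qed.

HB.instance Definition _ :=
  GRing.isZmodule.Build dlim dl_addA dl_addC dl_add0 dl_addN.

Lemma dl_mulA : associative dl_mul.
Proof. by apply: dlinW3 => m x y z; rewrite !dl_mulE mulmxA. Qed.
Lemma dl_mul1 : left_id dl_one dl_mul.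
Proof. by apply: dlinW => m x; rewrite (dl_oneE m) dl_mulE mul1mx. Qed.
Lemma dl_mulr1 : right_id dl_one dl_mul.
Proof. by apply: dlinW => m x; rewrite (dl_oneE m) dl_mulE mulmx1. Qed.
Lemma dl_mulDl : left_distributive dl_mul dl_add.
Proof.
by apply: dlinW3 => m x y z; rewrite !(dl_addE, dl_mulE) mulmxDl.
Qed.
Lemma dl_mulDr : right_distributive dl_mul dl_add.
Proof.
by apply: dlinW3 => m x y z; rewrite !(dl_addE, dl_mulE) mulmxDr.
Qed.
Lemma dl_one_neq0 : dl_one != 0.
Proof.
apply/eqP => /dlin_inj/(congr1 mxrank)/eqP.
by rewrite mxrank1 mxrank0 gtn_eqF// fseq_gt0.
Qed.

HB.instance Definition _ := GRing.Zmodule_isNzRing.Build dlim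
  dl_mulA dl_mul1 dl_mulr1 dl_mulDl dl_mulDr dl_one_neq0.

Lemma dl_scaleA c d a : dl_scale c (dl_scale d a) = dl_scale (c * d) a.
Proof. by move: a; apply: dlinW => m x; rewrite !dl_scaleE scalerA. Qed.
Lemma dl_scale1 : left_id 1 dl_scale.
Proof. by apply: dlinW => m x; rewrite dl_scaleE scale1r. Qed.
Lemma dl_scaleDr : right_distributive dl_scale dl_add.
Proof.
by move=> c; apply: dlinW2 => m x y; rewrite !(dl_addE, dl_scaleE) scalerDr.
Qed.
Lemma dl_scaleDl a : {morph dl_scale^~ a : c d / c + d >-> dl_add c d}.
Proof.
move=> c d; move: a; apply: dlinW => m x.
by rewrite !dl_scaleE dl_addE scalerDl.
Qed.

HB.instance Definition _ := GRing.Zmodule_isLmodule.Build F dlim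
  dl_scaleA dl_scale1 dl_scaleDr dl_scaleDl.

Lemma dl_scaleAl c a b : dl_scale c (dl_mul a b) = dl_mul (dl_scale c a) b.
Proof.
by move: a b; apply: dlinW2 => m x y; rewrite !(dl_mulE, dl_scaleE) scalemxAl.
Qed.
Lemma dl_scaleAr c a b : dl_scale c (dl_mul a b) = dl_mul a (dl_scale c b).
Proof.
by move: a b; apply: dlinW2 => m x y; rewrite !(dl_mulE, dl_scaleE) scalemxAr.
Qed.

HB.instance Definition _ := GRing.Lmodule_isLalgebra.Build F dlim dl_scaleAl.
HB.instance Definition _ := GRing.Lalgebra_isAlgebra.Build F dlim dl_scaleAr.

Definition dl_dist (a b : dlim) : R :=
  rkdist (at_level (dlev a b) (repr a)) (at_level (dlev a b) (repr b)).

Lemma dl_distE k (x y : 'M[F]_(s k)) : dl_dist (dlin x) (dlin y) = rkdist x y.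
Proof.
rewrite /dl_dist; set L := dlev _ _; pose p := maxn k L.
have [kp Lp] : (k <= p)%N /\ (L <= p)%N by rewrite leq_maxl leq_maxr.
have xL : (tag (repr (dlin x)) <= L)%N by rewrite leq_maxl.
have yL : (tag (repr (dlin y)) <= L)%N by rewrite leq_maxr.
rewrite -(@rkdist_ampl _ _ _ (s p)) ?fseq_gt0 ?fseq_dvdn// !at_level_ampl//.
rewrite !at_dlin ?(leq_trans xL) ?(leq_trans yL)//.
by rewrite rkdist_ampl ?fseq_gt0 ?fseq_dvdn.
Qed.

Lemma dl_distxx a : dl_dist a a = 0.
Proof. exact: rkdistxx. Qed.
Lemma dl_dist_pos a b : dl_dist a b = 0 -> a = b.
Proof.
by move: a b; apply: dlinW2 => m x y; rewrite dl_distE => /rkdist_pos ->.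
Qed.
Lemma dl_dist_sym a b : dl_dist a b = dl_dist b a.
Proof. by move: a b; apply: dlinW2 => m x y; rewrite !dl_distE rkdist_sym. Qed.
Lemma dl_dist_triangle b a c : dl_dist a c <= dl_dist a b + dl_dist b c.
Proof.
by move: b a c; apply: dlinW3 => m y x z; rewrite !dl_distE rkdist_triangle.
Qed.

HB.instance Definition _ := isMetric.Build R dlim
  dl_distxx dl_dist_pos dl_dist_sym dl_dist_triangle.

Lemma dl_distDr (c a b : dlim) : dl_dist (dl_add a c) (dl_add b c) = dl_dist a b.
Proof.
by move: c a b; apply: dlinW3 => m z x y; rewrite !dl_addE !dl_distE rkdistDr.
Qed.
Lemma dl_distMl (c a b : dlim) : dl_dist (dl_mul c a) (dl_mul c b) <= dl_dist a b.
Proof.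
by move: c a b; apply: dlinW3 => m z x y; rewrite !dl_mulE !dl_distE rkdistMl.
Qed.
Lemma dl_distMr (c a b : dlim) : dl_dist (dl_mul a c) (dl_mul b c) <= dl_dist a b.
Proof.
by move: c a b; apply: dlinW3 => m z x y; rewrite !dl_mulE !dl_distE rkdistMr.
Qed.
Lemma dl_distZ (c : F) (a b : dlim) : dl_dist (dl_scale c a) (dl_scale c b) <= dl_dist a b.
Proof.
by move: a b; apply: dlinW2 => m x y; rewrite !dl_scaleE !dl_distE rkdistZ.
Qed.

HB.instance Definition _ := hasContractiveOps.Build F R dlim
  dl_distDr dl_distMl dl_distMr dl_distZ.

Lemma dlinD k : {morph @dlin k : x y / x + y}.
Proof. by move=> x y; rewrite -dl_addE. Qed.
Lemma dlinM k : {morph @dlin k : x y / x *m y >-> x * y}.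
Proof. by move=> x y; rewrite -dl_mulE. Qed.
Lemma dlinZ k c : {morph @dlin k : x / c *: x}.
Proof. by move=> x; rewrite -dl_scaleE. Qed.
Lemma dlin1 k : @dlin k 1%:M = 1.
Proof. by rewrite -dl_oneE. Qed.
Lemma mdist_dlin k (x y : 'M[F]_(s k)) :
  mdist (dlin x) (dlin y) = rkdist x y.
Proof. exact: dl_distE. Qed.

End DirectLimit.

Section Completion.
Variables (F : fieldType) (R : realType) (A : metricAlgType F R).
Implicit Types x y z : A.

Definition cauchy_seq (u : nat -> A) : Prop := cauchy (u @ \oo).

Lemma cauchy_seqP (u : nat -> A) :
  cauchy_seq u <-> forall e : R, 0 < e ->
    exists N, forall i j, (N <= i)%N -> (N <= j)%N -> mdist (u i) (u j) < e.
Proof.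
rewrite /cauchy_seq -cauchy_ballP; split => [H e e0|H e e0].
  have [[P Q] [/= [N1 _ P1] [N2 _ Q2]] PQ] := H e e0.
  exists (maxn N1 N2) => i j; rewrite !geq_max => /andP[i1 i2] /andP[j1 j2].
  have := PQ (u i, u j) (conj (P1 i i1) (Q2 j j2)).
  by rewrite /= ballEmdist.
have [N HN] := H e e0.
exists (u @` [set i | (N <= i)%N], u @` [set i | (N <= i)%N]).
  by split; exists N => // i /= Ni; exists i.
by move=> [_ _] [/= [i Ni <-] [j Nj <-]]; rewrite /= ballEmdist; apply: HN.
Qed.

Local Notation S := {u : nat -> A | `[< cauchy_seq u >]}.
Implicit Types u v w : S.

Definition mkS (u : nat -> A) (cu : cauchy_seq u) : S := exist _ u (asboolT cu).

Lemma cauchyS u : cauchy_seq (val u).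
Proof. by case: u => u /= /asboolP. Qed.

Lemma mdistD x y x' y' : mdist (x + y) (x' + y') <= mdist x x' + mdist y y'.
Proof.
apply: le_trans (metric_triangle _ (x' + y) _) _.
by rewrite mdistDr [x' + y]addrC [x' + y']addrC mdistDr.
Qed.

Lemma mdistM x y x' y' : mdist (x * y) (x' * y') <= mdist x x' + mdist y y'.
Proof.
apply: le_trans (metric_triangle _ (x' * y) _) _.
by rewrite lerD// ?mdistMr ?mdistMl.
Qed.

Lemma mdistN x y : mdist (- x) (- y) = mdist x y.
Proof.
by rewrite -(mdistDr (x + y)) addKr addrCA addNr addr0 metric_sym.
Qed.

Lemma mdistN_le x y : mdist (- x) (- y) <= mdist x y.
Proof. by rewrite mdistN. Qed.

Lemma mdist_sub x y x' y' :
  `|mdist x y - mdist x' y'| <= mdist x x' + mdist y y'.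
Proof.
have h a b c d : mdist a b - mdist c d <= mdist a c + mdist b d :> R.
  rewrite lerBlDr -addrA; apply: le_trans (metric_triangle _ c _) _.
  rewrite lerD2l; apply: le_trans (metric_triangle _ d _) _.
  by rewrite [mdist d b]metric_sym addrC.
rewrite ler_norml h andbT lerNl opprB.
by rewrite [mdist x x']metric_sym [mdist y y']metric_sym h.
Qed.

Lemma cauchy_lift2 (f : A -> A -> A) (u v : S) :
  (forall x y x' y', mdist (f x y) (f x' y') <= mdist x x' + mdist y y') ->
  cauchy_seq (fun i => f (val u i) (val v i)).
Proof.
move=> fL; apply/cauchy_seqP => e e0; have e2 : 0 < e / 2 by rewrite divr_gt0.
have /cauchy_seqP/(_ _ e2)[N1 H1] := cauchyS u.
have /cauchy_seqP/(_ _ e2)[N2 H2] := cauchyS v.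
exists (maxn N1 N2) => i j; rewrite !geq_max => /andP[i1 i2] /andP[j1 j2].
apply: le_lt_trans (fL _ _ _ _) _.
by rewrite [e]splitr ltrD// ?H1 ?H2.
Qed.

Lemma cauchy_lift1 (f : A -> A) (u : S) :
  (forall x y, mdist (f x) (f y) <= mdist x y) ->
  cauchy_seq (fun i => f (val u i)).
Proof.
move=> fL; apply/cauchy_seqP => e e0.
have /cauchy_seqP/(_ _ e0)[N H] := cauchyS u.
by exists N => i j iN jN; apply: le_lt_trans (fL _ _) _; apply: H.
Qed.

Lemma cauchy_cst x : cauchy_seq (fun=> x).
Proof. by apply/cauchy_seqP => e e0; exists 0 => i j _ _; rewrite mdistxx. Qed.

Definition cs_add u v : S := mkS (cauchy_lift2 u v mdistD).
Definition cs_mul u v : S := mkS (cauchy_lift2 u v mdistM).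
Definition cs_opp u : S := mkS (cauchy_lift1 u mdistN_le).
Definition cs_scale (c : F) u : S := mkS (cauchy_lift1 u (mdistZ c)).
Definition cs_cst x : S := mkS (cauchy_cst x).

Definition cs_dist u v : nat -> R := fun i => mdist (val u i) (val v i).

Lemma cs_dist_cvg0P u v : cs_dist u v @ \oo --> (0 : R) <->
  forall e : R, 0 < e ->
    exists N, forall i, (N <= i)%N -> mdist (val u i) (val v i) < e.
Proof.
split => [/cvgr0Pnorm_lt H e e0|H].
  have [N _ HN] := H e e0; exists N => i /HN /=.
  by rewrite ger0_norm// mdist_ge0.
apply/cvgr0Pnorm_lt => e e0; have [N HN] := H e e0.
by exists N => // i /= /HN; rewrite ger0_norm ?mdist_ge0.
Qed.

Definition cs_eq u v : bool := `[< cs_dist u v @ \oo --> (0 : R) >].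

Lemma cs_eq_refl : reflexive cs_eq.
Proof.
by move=> u; apply/asboolP/cs_dist_cvg0P => e e0; exists 0 => i; rewrite mdistxx.
Qed.

Lemma cs_dist_sym u v : cs_dist u v = cs_dist v u.
Proof. by apply/funext => i; apply: metric_sym. Qed.

Lemma cs_eq_sym : symmetric cs_eq.
Proof. by move=> u v; rewrite /cs_eq cs_dist_sym. Qed.

Lemma cs_eq_trans : transitive cs_eq.
Proof.
move=> v u w /asboolP/cs_dist_cvg0P uv /asboolP/cs_dist_cvg0P vw.
apply/asboolP/cs_dist_cvg0P => e e0; have e2 : 0 < e / 2 by rewrite divr_gt0.
have [N1 H1] := uv _ e2; have [N2 H2] := vw _ e2.
exists (maxn N1 N2) => i; rewrite geq_max => /andP[i1 i2].
apply: le_lt_trans (metric_triangle _ (val v i) _) _.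
by rewrite [e]splitr ltrD// ?H1 ?H2.
Qed.

Canonical cs_equiv := EquivRel cs_eq cs_eq_refl cs_eq_sym cs_eq_trans.

Definition completion : Type := {eq_quot cs_equiv}.
HB.instance Definition _ := Choice.on completion.
HB.instance Definition _ := EqQuotient.on completion.

Definition cpi u : completion := \pi_(completion) u.
Implicit Types a b c : completion.

Lemma cpi_repr a : cpi (repr a) = a.
Proof. exact: reprK. Qed.

Lemma cpiP u v : cpi u = cpi v <-> cs_dist u v @ \oo --> (0 : R).
Proof.
split; first by move/eqP; rewrite /cpi eqquotE => /asboolP.
by move=> uv; apply/eqP; rewrite /cpi eqquotE; apply/asboolP.
Qed.

Lemma cpi_ext u v : (forall i, val u i = val v i) -> cpi u = cpi v.
Proof.
by move=> uv; congr cpi; apply: val_inj; apply/funext.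
Qed.

Lemma repr_cpi u : cs_dist u (repr (cpi u)) @ \oo --> (0 : R).
Proof. by apply/cpiP; rewrite cpi_repr. Qed.

Definition c_add a b : completion := cpi (cs_add (repr a) (repr b)).
Definition c_mul a b : completion := cpi (cs_mul (repr a) (repr b)).
Definition c_opp a : completion := cpi (cs_opp (repr a)).
Definition c_scale (k : F) a : completion := cpi (cs_scale k (repr a)).
Definition c_incl x : completion := cpi (cs_cst x).

(* The limit exists by [c_dist_cvg] below. *)
Definition c_dist a b : R := lim (cs_dist (repr a) (repr b) @ \oo).

Lemma cpi_lift2 (f : A -> A -> A) u v u' v' w w' :
  (forall x y x' y', mdist (f x y) (f x' y') <= mdist x x' + mdist y y') ->
  (forall i, val w i = f (val u i) (val v i)) ->
  (forall i, val w' i = f (val u' i) (val v' i)) ->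
  cpi u = cpi u' -> cpi v = cpi v' -> cpi w = cpi w'.
Proof.
move=> fL wE w'E /cpiP/cs_dist_cvg0P uu /cpiP/cs_dist_cvg0P vv.
apply/cpiP/cs_dist_cvg0P => e e0; have e2 : 0 < e / 2 by rewrite divr_gt0.
have [N1 H1] := uu _ e2; have [N2 H2] := vv _ e2.
exists (maxn N1 N2) => i; rewrite geq_max => /andP[i1 i2].
rewrite wE w'E; apply: le_lt_trans (fL _ _ _ _) _.
by rewrite [e]splitr ltrD// ?H1 ?H2.
Qed.

Lemma c_addE u v : c_add (cpi u) (cpi v) = cpi (cs_add u v).
Proof. by apply: (cpi_lift2 mdistD) => //; rewrite cpi_repr. Qed.

Lemma c_mulE u v : c_mul (cpi u) (cpi v) = cpi (cs_mul u v).
Proof. by apply: (cpi_lift2 mdistM) => //; rewrite cpi_repr. Qed.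

Lemma cpi_lift1 (f : A -> A) u u' w w' :
  (forall x y, mdist (f x) (f y) <= mdist x y) ->
  (forall i, val w i = f (val u i)) -> (forall i, val w' i = f (val u' i)) ->
  cpi u = cpi u' -> cpi w = cpi w'.
Proof.
move=> fL wE w'E /cpiP/cs_dist_cvg0P uu; apply/cpiP/cs_dist_cvg0P => e e0.
have [N H] := uu _ e0; exists N => i iN.
by rewrite wE w'E; apply: le_lt_trans (fL _ _) _; apply: H.
Qed.

Lemma c_oppE u : c_opp (cpi u) = cpi (cs_opp u).
Proof. by apply: (cpi_lift1 mdistN_le) => //; rewrite cpi_repr. Qed.

Lemma c_scaleE k u : c_scale k (cpi u) = cpi (cs_scale k u).
Proof. by apply: (cpi_lift1 (mdistZ k)) => //; rewrite cpi_repr. Qed.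

Lemma cpiW (P : completion -> Prop) : (forall u, P (cpi u)) -> forall a, P a.
Proof. by move=> H a; rewrite -(cpi_repr a). Qed.

Lemma c_addA : associative c_add.
Proof.
elim/cpiW => u; elim/cpiW => v; elim/cpiW => w.
by rewrite !c_addE; apply: cpi_ext => i; apply: addrA.
Qed.
Lemma c_addC : commutative c_add.
Proof.
elim/cpiW => u; elim/cpiW => v.
by rewrite !c_addE; apply: cpi_ext => i; apply: addrC.
Qed.
Lemma c_add0 : left_id (c_incl 0) c_add.
Proof.
by elim/cpiW => u; rewrite c_addE; apply: cpi_ext => i; apply: add0r.
Qed.
Lemma c_addN : left_inverse (c_incl 0) c_opp c_add.
Proof.
by elim/cpiW => u; rewrite c_oppE c_addE; apply: cpi_ext => i; apply: addNr.
Qed.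

HB.instance Definition _ :=
  GRing.isZmodule.Build completion c_addA c_addC c_add0 c_addN.

Lemma c_mulA : associative c_mul.
Proof.
elim/cpiW => u; elim/cpiW => v; elim/cpiW => w.
by rewrite !c_mulE; apply: cpi_ext => i; apply: mulrA.
Qed.
Lemma c_mul1 : left_id (c_incl 1) c_mul.
Proof.
by elim/cpiW => u; rewrite c_mulE; apply: cpi_ext => i; apply: mul1r.
Qed.
Lemma c_mulr1 : right_id (c_incl 1) c_mul.
Proof.
by elim/cpiW => u; rewrite c_mulE; apply: cpi_ext => i; apply: mulr1.
Qed.
Lemma c_mulDl : left_distributive c_mul c_add.
Proof.
elim/cpiW => u; elim/cpiW => v; elim/cpiW => w.
by rewrite !(c_addE, c_mulE); apply: cpi_ext => i; apply: mulrDl.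
Qed.
Lemma c_mulDr : right_distributive c_mul c_add.
Proof.
elim/cpiW => u; elim/cpiW => v; elim/cpiW => w.
by rewrite !(c_addE, c_mulE); apply: cpi_ext => i; apply: mulrDr.
Qed.
Lemma c_incl_inj : injective c_incl.
Proof.
move=> x y /cpiP/cs_dist_cvg0P H; apply: mdist_positivity.
apply/eqP; rewrite eq_le mdist_ge0 andbT; apply/ler_addgt0Pr => e e0.
by have [N /(_ N (leqnn N))/ltW] := H _ e0; rewrite add0r.
Qed.
Lemma c_one_neq0 : c_incl 1 != 0.
Proof. by apply/eqP => /c_incl_inj/eqP; rewrite oner_eq0. Qed.

HB.instance Definition _ := GRing.Zmodule_isNzRing.Build completion
  c_mulA c_mul1 c_mulr1 c_mulDl c_mulDr c_one_neq0.

Lemma c_scaleA k l a : c_scale k (c_scale l a) = c_scale (k * l) a.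
Proof.
elim/cpiW: a => u; rewrite !c_scaleE; apply: cpi_ext => i; exact: scalerA.
Qed.
Lemma c_scale1 : left_id 1 c_scale.
Proof.
elim/cpiW => u; rewrite c_scaleE; apply: cpi_ext => i; exact: scale1r.
Qed.
Lemma c_scaleDr : right_distributive c_scale c_add.
Proof.
move=> k; elim/cpiW => u; elim/cpiW => v.
by rewrite !(c_addE, c_scaleE); apply: cpi_ext => i; apply: scalerDr.
Qed.
Lemma c_scaleDl a : {morph c_scale^~ a : k l / k + l >-> c_add k l}.
Proof.
move=> k l; elim/cpiW: a => u.
by rewrite !c_scaleE c_addE; apply: cpi_ext => i; apply: scalerDl.
Qed.

HB.instance Definition _ := GRing.Zmodule_isLmodule.Build F completion
  c_scaleA c_scale1 c_scaleDr c_scaleDl.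

Lemma c_scaleAl k a b : c_scale k (c_mul a b) = c_mul (c_scale k a) b.
Proof.
elim/cpiW: a => u; elim/cpiW: b => v.
by rewrite !(c_mulE, c_scaleE); apply: cpi_ext => i; apply: scalerAl.
Qed.
Lemma c_scaleAr k a b : c_scale k (c_mul a b) = c_mul a (c_scale k b).
Proof.
elim/cpiW: a => u; elim/cpiW: b => v.
by rewrite !(c_mulE, c_scaleE); apply: cpi_ext => i; apply: scalerAr.
Qed.

HB.instance Definition _ := GRing.Lmodule_isLalgebra.Build F completion
  c_scaleAl.
HB.instance Definition _ := GRing.Lalgebra_isAlgebra.Build F completion
  c_scaleAr.

Lemma cs_dist_is_cvg u v : cvg (cs_dist u v @ \oo).
Proof.
apply: cauchy_cvg; rewrite -cauchy_ballP => e e0.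
have e2 : 0 < e / 2 by rewrite divr_gt0.
have /cauchy_seqP/(_ _ e2)[N1 H1] := cauchyS u.
have /cauchy_seqP/(_ _ e2)[N2 H2] := cauchyS v.
pose B := [set i | (maxn N1 N2 <= i)%N].
exists (cs_dist u v @` B, cs_dist u v @` B).
  by split; exists (maxn N1 N2) => // i /= Ni; exists i.
move=> [_ _] [/= [i Ni <-] [j Nj <-]]; rewrite /ball /=.
move: Ni Nj; rewrite /B/= !geq_max => /andP[i1 i2] /andP[j1 j2].
apply: le_lt_trans (mdist_sub _ _ _ _) _.
by rewrite [e]splitr ltrD// ?H1 ?H2.
Qed.

Lemma c_dist_cvg u v : cs_dist u v @ \oo --> c_dist (cpi u) (cpi v).
Proof.
rewrite /c_dist; set u' := repr _; set v' := repr (cpi v).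
have uu : cs_dist u u' @ \oo --> (0 : R) by apply: repr_cpi.
have vv : cs_dist v v' @ \oo --> (0 : R) by apply: repr_cpi.
have cv : cvg (cs_dist u' v' @ \oo)  by apply: cs_dist_is_cvg.
rewrite -[X in _ --> X]add0r.
have -> : cs_dist u v = (cs_dist u v - cs_dist u' v') + cs_dist u' v'.
  by apply/funext => i; rewrite /= !fctE subrK.
apply: cvgD => //; apply: norm_cvg0.
apply: (@squeeze_cvgr _ _ _ _ (cst 0) (cs_dist u u' + cs_dist v v')).
- by apply: nearW => i; rewrite normr_ge0/=; apply: mdist_sub.
- exact: cvg_cst.
- by rewrite -[X in _ --> X](addr0 0); apply: cvgD.
Qed.

Lemma c_distxx a : c_dist a a = 0.
Proof.
elim/cpiW: a => u.
have uu : cs_dist u u @ \oo --> (0 : R) by apply/cpiP.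
by apply: cvg_unique (@c_dist_cvg u u) uu; apply: norm_hausdorff.
Qed.
Lemma c_dist_pos a b : c_dist a b = 0 -> a = b.
Proof.
by elim/cpiW: a => u; elim/cpiW: b => v uv0; apply/cpiP; rewrite -uv0;
  apply: c_dist_cvg.
Qed.
Lemma c_dist_sym a b : c_dist a b = c_dist b a.
Proof. by rewrite /c_dist cs_dist_sym. Qed.
Lemma c_dist_triangle b a c : c_dist a c <= c_dist a b + c_dist b c.
Proof.
elim/cpiW: b => v; elim/cpiW: a => u; elim/cpiW: c => w.
apply: (ler_cvg_to (@c_dist_cvg u w)
  (cvgD (@c_dist_cvg u v) (@c_dist_cvg v w))).
by apply: nearW => i; apply: metric_triangle.
Qed.

HB.instance Definition _ := isMetric.Build R completion
  c_distxx c_dist_pos c_dist_sym c_dist_triangle.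

Lemma c_distDr c a b : c_dist (c_add a c) (c_add b c) = c_dist a b.
Proof.
elim/cpiW: c => w; elim/cpiW: a => u; elim/cpiW: b => v; rewrite !c_addE.
have := @c_dist_cvg (cs_add u w) (cs_add v w).
have -> : cs_dist (cs_add u w) (cs_add v w) = cs_dist u v.
  by apply/funext => i; apply: mdistDr.
move=> h; apply: cvg_unique h (@c_dist_cvg u v); exact: norm_hausdorff.
Qed.
Lemma c_distMl c a b : c_dist (c_mul c a) (c_mul c b) <= c_dist a b.
Proof.
elim/cpiW: c => w; elim/cpiW: a => u; elim/cpiW: b => v; rewrite !c_mulE.
apply: (ler_cvg_to (@c_dist_cvg _ _) (@c_dist_cvg _ _)).
by apply: nearW => i; apply: mdistMl.
Qed.
Lemma c_distMr c a b : c_dist (c_mul a c) (c_mul b c) <= c_dist a b.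
Proof.
elim/cpiW: c => w; elim/cpiW: a => u; elim/cpiW: b => v; rewrite !c_mulE.
apply: (ler_cvg_to (@c_dist_cvg _ _) (@c_dist_cvg _ _)).
by apply: nearW => i; apply: mdistMr.
Qed.
Lemma c_distZ k a b : c_dist (c_scale k a) (c_scale k b) <= c_dist a b.
Proof.
elim/cpiW: a => u; elim/cpiW: b => v; rewrite !c_scaleE.
apply: (ler_cvg_to (@c_dist_cvg _ _) (@c_dist_cvg _ _)).
by apply: nearW => i; apply: mdistZ.
Qed.

HB.instance Definition _ := hasContractiveOps.Build F R completion
  c_distDr c_distMl c_distMr c_distZ.

Lemma c_incl_linear : linear c_incl.
Proof.
move=> k x y; rewrite -[RHS]/(c_add (c_scale k _) _) c_scaleE c_addE.
exact: cpi_ext.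
Qed.
Lemma c_incl_multiplicative : monoid_morphism c_incl.
Proof.
split=> // x y; rewrite -[RHS]/(c_mul _ _) c_mulE; exact: cpi_ext.
Qed.

HB.instance Definition _ :=
  GRing.isLinear.Build F A completion *:%R c_incl c_incl_linear.
HB.instance Definition _ :=
  GRing.isMonoidMorphism.Build A completion c_incl c_incl_multiplicative.

Lemma mdist_cpi u v : cs_dist u v @ \oo --> (mdist (cpi u) (cpi v) : R).
Proof. exact: c_dist_cvg. Qed.

Lemma mdist_incl x y : mdist (c_incl x) (c_incl y) = mdist x y.
Proof.
have h : cs_dist (cs_cst x) (cs_cst y) @ \oo --> (mdist x y : R).
  by rewrite (_ : cs_dist _ _ = cst (mdist x y)) //; apply: cvg_cst.
apply: cvg_unique (@mdist_cpi _ _) h; exact: norm_hausdorff.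
Qed.

Lemma c_incl_dense a (e : R) : 0 < e -> exists x, mdist (c_incl x) a < e.
Proof.
elim/cpiW: a => u e0; have e2 : 0 < e / 2 by rewrite divr_gt0.
have /cauchy_seqP/(_ _ e2)[N H] := cauchyS u.
exists (val u N); apply: le_lt_trans (_ : e / 2 < e); last first.
  by rewrite ltr_pdivrMr// ltr_pMr// ltr1n.
apply: (ler_cvg_to (@mdist_cpi _ _) (cvg_cst (e / 2))).
by exists N => // i /= Ni; apply/ltW/H.
Qed.

End Completion.

Lemma completion_complete (F : fieldType) (R : realType)
    (A : metricAlgType F R) (w : nat -> completion A) :
  cauchy (w @ \oo) -> exists a : completion A, w @ \oo --> a.
Proof.
move=> cw.
have /choice[x xw] (n : nat) : exists x : A, mdist (c_incl x) (w n) < n.+1%:R^-1 :> R.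
  by apply: c_incl_dense; rewrite invr_gt0.
have x_near (e : R) : 0 < e ->
    exists N, forall n, (N <= n)%N -> mdist (c_incl (x n)) (w n) < e.
  move=> e0; have [N _ HN] := near_infty_natSinv_lt (interval_inference.PosNum e0).
  by exists N => n /HN; apply: lt_trans.
have cx : cauchy_seq x.
  apply/cauchy_seqP => e e0; have e3 : 0 < e / 3 by rewrite divr_gt0.
  have [N1 H1] := x_near _ e3.
  have /(cauchy_seqP w)/(_ _ e3)[N2 H2] := cw.
  exists (maxn N1 N2) => i j; rewrite !geq_max => /andP[i1 i2] /andP[j1 j2].
  rewrite -mdist_incl; apply: le_lt_trans (metric_triangle _ (w i) _) _.
  apply: le_lt_trans (lerD (lexx _) (metric_triangle _ (w j) _)) _.
  rewrite (_ : e = e / 3 + (e / 3 + e / 3)); last first.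
    by field.
  by rewrite !ltrD ?H1 ?H2// metric_sym H1.
exists (cpi (mkS cx)).
apply/metricType_numDomainType.cvgrPdist_lt => e e0.
have e2 : 0 < e / 2 by rewrite divr_gt0.
have e4 : 0 < e / 4 by rewrite divr_gt0.
have [N1 H1] := x_near _ e2.
have /cauchy_seqP/(_ _ e4)[N2 H2] := cx.
exists (maxn N1 N2) => // i /=; rewrite geq_max => /andP[i1 i2].
apply: le_lt_trans (metric_triangle _ (c_incl (x i)) _) _.
rewrite [e]splitr ler_ltD ?H1//.
have h : mdist (cpi (mkS cx)) (c_incl (x i)) <= e / 4.
  apply: (ler_cvg_to (@mdist_cpi F R A (mkS cx) (cs_cst (x i)))
    (cvg_cst (e / 4))).
  by exists N2 => // j /= Nj; apply/ltW/H2.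
by apply: le_trans h _; rewrite ler_pM2l// lef_pV2 ?posrE ?ler_nat.
Qed.

Section Embeddings.
Variables (F : fieldType) (R : realType).
Implicit Types A B : metricAlgType F R.

Record embedding A B := Embedding {
  embedding_fun :> {lrmorphism A -> B};
  embedding_isometry : forall x y,
    mdist (embedding_fun x) (embedding_fun y) = mdist x y
}.

Record automorphism A := Automorphism {
  automorphism_embedding :> embedding A A;
  automorphism_surj : forall y, exists x, automorphism_embedding x = y
}.

Definition map_dist A B (f g : A -> B) : \bar R :=
  ereal_sup [set (mdist (f x) (g x))%:E | x in [set: A]].

Definition limit_algebra (s : factorSeq) : metricAlgType F R :=
  completion (dlim F R s).

Definition K_structure A : Prop :=
  exists (s : factorSeq) (f : embedding A (limit_algebra s)),
    forall y, exists x, f x = y.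

End Embeddings.

(* Main.v *)
Require Import Defs.
From HB Require Import structures.
From mathcomp Require Import all_boot all_order all_algebra.
From mathcomp Require Import all_classical all_reals all_analysis.
From mathcomp Require Import ring lra zify.
From mathcomp.real_closed Require Import mxtens.

Set Implicit Arguments.
Unset Strict Implicit.
Unset Printing Implicit Defensive.

Import Order.TTheory GRing.Theory Num.Theory.
Import numFieldNormedType.Exports.

Local Open Scope classical_set_scope.
Local Open Scope ring_scope.

(* Matrix units are stable in rank: N x N matrices e_ij which satisfy the
   matrix unit relations up to total rank c are conjugate, up to rank c, to the
   standard system S_ij consisting of floor(N/p) diagonal blocks E_ij followed
   by zeros. Hence approximate matrix units in the direct limit are all
   approximately conjugate to each other.
   Universality: the S_ij become exact as N grows, and conjugating them
   successively makes them a Cauchy sequence whose limit is a system of exact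
   matrix units. The resulting unital homomorphism is isometric because, by the
   Frobenius rank inequality, the rank is additive on orthogonal idempotents.
   Homogeneity: approximate the images of the E_ij under two embeddings by
   elements of the direct limit, and conjugate one system close to the other. *)

(** * Rank stability of matrix units *)

Section ApproximateMatrixUnits.
Variable F : fieldType.

Lemma mxrank_rows0 (N m : nat) (M : 'M[F]_N) :
  (forall i : 'I_N, (i < m)%N -> row i M = 0) -> (\rank M <= N - m)%N.
Proof.
move=> M0; have [mN|Nm] := leqP m N; last first.
  suff -> : M = 0 by rewrite mxrank0.
  by apply/row_matrixP => i; rewrite row0 M0// (ltn_trans (ltn_ord i)).
have pM : pid_mx m *m M = 0 :> 'M[F]_N.
  apply/matrixP => i j; rewrite !mxE big1// => k _; rewrite mxE.
  have [ik|] := boolP ((i : nat) == k); last by rewrite mul0r.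
  have [im|] := boolP (i < m)%N; last by rewrite mul0r.
  have := M0 k; rewrite -(eqP ik) => /(_ im)/rowP/(_ j).
  by rewrite !mxE => ->; rewrite mulr0.
rewrite -(@rank_copid_mx F N m mN).
have <- : copid_mx m *m M = M by rewrite mulmxBl mul1mx pM subr0.
exact: mxrankM_maxl.
Qed.

(** The kernel of [D t] has codimension [\rank (D t)], and codimensions are subadditive under
    intersection. *)
Lemma mxrank_bigcap_ker (I : Type) (r : seq I) (N : nat) (D : I -> 'M[F]_N) :
  (N <= \rank (\bigcap_(t <- r) kermx (D t))%MS + \sum_(t <- r) \rank (D t))%N.
Proof.
elim: r => [|t r IH]; first by rewrite !big_nil mxrank1 addn0.
rewrite !big_cons; set K := kermx (D t); set W := (\bigcap_(_ <- r) _)%MS in IH *.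
have := mxrank_sum_cap K W; rewrite mxrank_ker.
have : (\rank (K + W)%MS <= N)%N by apply: rank_leq_col.
have : (\rank (D t) <= N)%N by apply: rank_leq_col.
move: IH; lia.
Qed.

(** Completion to a basis by Gaussian elimination: [B] is L [1 0] U with L and U invertible, and
    diag(L, 1) U is an invertible matrix with top block [B]. *)
Lemma row_free_extend (m N : nat) (B : 'M[F]_(m, N)) : row_free B ->
  exists2 P : 'M[F]_N, P \in unitmx &
    forall (i : 'I_m) (x : 'I_N), val x = val i -> row x P = row i B.
Proof.
move=> Bf; have mN : (m <= N)%N by rewrite -(eqP Bf) rank_leq_col.
move: B Bf; rewrite -(subnKC mN); move: (N - m)%N => c B Bf.
pose L := col_ebase B; pose U := row_ebase B.
exists (block_mx L 0 0 1%:M *m U).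
  rewrite unitmx_mul row_ebase_unit andbT unitmxE det_ublock det1 mulr1.
  by rewrite -unitmxE col_ebase_unit.
have PB : usubmx (block_mx L 0 0 1%:M *m U) = B.
  rewrite -[in RHS](mulmx_ebase B) (eqP Bf) -mulmxA.
  rewrite -[row_ebase B]vsubmxK -/U -[X in block_mx _ _ _ _ *m X]vsubmxK.
  rewrite -/U mul_block_col col_mxKu mul0mx addr0; congr (_ *m _).
  by rewrite pid_mx_row mul_row_col mul1mx mul0mx addr0.
move=> i x xi; rewrite -[in RHS]PB; apply/rowP => j; rewrite !mxE.
by apply: eq_bigr => k _; congr (block_mx _ _ _ _ _ _ * _); apply: val_inj.
Qed.

Lemma mulmxMn m N q (A : 'M[F]_(m, N)) (B : 'M[F]_(N, q)) c :
  A *m (B *+ c) = (A *m B) *+ c.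
Proof. exact: raddfMn. Qed.

Section Units.
Variable n : nat.
Local Notation p := n.+1.
Implicit Types i j k l : 'I_p.

(* The system x |-> x (x) 1 with the opposite ordering of the tensor factors,
   so that systems with different numbers of blocks agree on leading rows. *)
Definition std_unit N k l : 'M[F]_N := \matrix_(x, y)
  [&& x %/ p < N %/ p, x %% p == k & (y : nat) == x %/ p * p + l]%N%:R.

Lemma std_unit_mulmx N q k l (M : 'M[F]_(N, q)) (x z : 'I_N) :
    (x %/ p < N %/ p)%N -> val z = (x %/ p * p + l)%N ->
  row x (std_unit N k l *m M) = (x %% p == k)%N%:R *: row z M.
Proof.
move=> xN zE; apply/rowP => y; rewrite !mxE (bigD1 z)//= big1 => [|w wz].
  by rewrite !mxE xN/= zE eqxx andbT addr0.
rewrite !mxE xN -zE val_eqE (negbTE wz) andbF mul0r//.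
Qed.

Lemma std_unit_row0 N k l (x : 'I_N) : (N %/ p <= x %/ p)%N ->
  row x (std_unit N k l) = 0.
Proof. by move=> Nx; apply/rowP => y; rewrite !mxE ltnNge Nx. Qed.

Lemma std_index_subproof N l (x : 'I_N) : (x %/ p < N %/ p)%N ->
  (x %/ p * p + l < N)%N.
Proof.
move=> xN; apply: leq_trans (_ : (x %/ p).+1 * p <= N)%N.
  by rewrite mulSn addnC ltn_add2r.
by rewrite (leq_trans _ (leq_trunc_div N p))// leq_mul2r xN orbT.
Qed.

Lemma std_unitM N i j k l :
  std_unit N i j *m std_unit N k l = std_unit N i l *+ (j == k).
Proof.
apply/row_matrixP => x; rewrite raddfMn/=.
have [xN|Nx] := ltnP (x %/ p) (N %/ p); last first.
  by rewrite row_mul !std_unit_row0// mul0mx mul0rn.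
pose z := Ordinal (std_index_subproof j xN).
rewrite (@std_unit_mulmx _ _ _ j _ _ z)//; apply/rowP => y.
have zd : (z %/ p = x %/ p)%N by rewrite /= divnMDl// (divn_small (ltn_ord j)) addn0.
have zm : (z %% p = j)%N by rewrite /= modnMDl (modn_small (ltn_ord j)).
rewrite !mxE mulmxnE !mxE zd zm xN/= val_eqE.
by case: (j == k); rewrite /= ?mulr0// -natrM mulnb.
Qed.

(** The sum agrees with the identity on the rows of the complete blocks, which leaves only the last
    N mod p rows. *)
Lemma rank_sum_std_unit N : (\rank (\sum_i std_unit N i i - 1%:M)%R <= p)%N.
Proof.
apply: leq_trans (_ : N - N %/ p * p <= p)%N; last first.
  by rewrite {1}(divn_eq N p) addKn ltnW// ltn_mod.
apply: mxrank_rows0 => x xN; have {}xN : (x %/ p < N %/ p)%N by rewrite ltn_divLR.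
apply/rowP => y; rewrite !mxE summxE.
have mp : (x %% p < p)%N by rewrite ltn_mod.
rewrite (bigD1 (Ordinal mp))//= big1 => [|i ix].
  by rewrite !mxE xN/= eqxx -divn_eq addr0 [y == x :> nat]eq_sym val_eqE subrr.
by rewrite !mxE xN/= (_ : _ == _ = false)//; apply: contraNF ix => /eqP e;
  apply/eqP/val_inj.
Qed.

Definition unit_defect N (e : 'I_p -> 'I_p -> 'M[F]_N) : nat :=
  (\sum_(t : ('I_p * 'I_p) * ('I_p * 'I_p))
    \rank (e t.1.1 t.1.2 *m e t.2.1 t.2.2 - e t.1.1 t.2.2 *+ (t.1.2 == t.2.1))%R
  + \rank (\sum_i e i i - 1%:M)%R)%N.

(* Vectors of the form v e_(i0), with v annihilating all the defects, generate
   an exact module over the matrix units. *)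
Lemma exact_units N (e : 'I_p -> 'I_p -> 'M[F]_N) :
  exists r (B : 'M[F]_(r * p, N)),
    [/\ row_free B, (N - r * p <= unit_defect e)%N
      & forall k l (a : 'I_r) j, row (mxtens_index (a, j)) B *m e k l =
          (j == k)%:R *: row (mxtens_index (a, l)) B].
Proof.
pose D (t : ('I_p * 'I_p) * ('I_p * 'I_p)) :=
  e t.1.1 t.1.2 *m e t.2.1 t.2.2 - e t.1.1 t.2.2 *+ (t.1.2 == t.2.1).
pose D0 := \sum_i e i i - 1%:M.
pose V0 := (\bigcap_t kermx (D t))%MS.
pose V := (V0 :&: kermx D0)%MS.
have VD : (N <= \rank V + unit_defect e)%N.
  have := mxrank_sum_cap V0 (kermx D0); rewrite -/V mxrank_ker.
  have : (\rank (V0 + kermx D0)%MS <= N)%N by apply: rank_leq_col.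
  have : (\rank D0 <= N)%N by apply: rank_leq_col.
  have := mxrank_bigcap_ker (index_enum _) D; rewrite -/V0.
  rewrite (_ : unit_defect e = (\sum_t \rank (D t) + \rank D0)%N)//; lia.
have VM i j k l : V *m e i j *m e k l = V *m e i l *+ (j == k).
  apply/eqP; rewrite -mulmxA -mulmxMn -subr_eq0 -mulmxBr; apply/eqP/sub_kermxP.
  rewrite -[X in kermx X]/(D ((i, j), (k, l))).
  by apply: submx_trans (capmxSl _ _) _; apply: (bigcapmx_inf ((i, j), (k, l))).
have V1 : \sum_i V *m e i i = V.
  apply/eqP; rewrite -mulmx_sumr -subr_eq0 -[X in _ - X]mulmx1 -mulmxBr.
  by apply/eqP/sub_kermxP/capmxSr.
(* By [VM], e_(00) fixes each V e_(i0), so it acts as the identity on [X]. The rows of [B] below are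
   b_a e_(0j), where the b_a form a basis of [X]. *)
pose X := (\sum_i (V *m e i ord0))%MS.
pose b := row_base X.
have b0 (M : 'M[F]_N) : (forall i, V *m e i ord0 *m M = 0) -> b *m M = 0.
  move=> VM0; apply/sub_kermxP; rewrite eq_row_base.
  by apply/sumsmx_subP => i _; apply/sub_kermxP.
have bM j k l : b *m e ord0 j *m e k l = b *m e ord0 l *+ (j == k).
  apply/eqP; rewrite -mulmxA -mulmxMn -subr_eq0 -mulmxBr; apply/eqP/b0 => i.
  by rewrite mulmxBr mulmxMn !mulmxA !VM !eqxx !mulr1n subrr.
have b1 : b *m e ord0 ord0 = b.
  apply/eqP; rewrite -subr_eq0 -[X in _ - X]mulmx1 -mulmxBr; apply/eqP/b0 => i.
  by rewrite mulmxBr mulmx1 VM eqxx subrr.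
exists (\rank X).
pose B : 'M[F]_(\rank X * p, N) :=
  \matrix_t (row (mxtens_unindex t).1 b *m e ord0 (mxtens_unindex t).2).
have BE a j : row (mxtens_index (a, j)) B = row a b *m e ord0 j.
  by rewrite rowK mxtens_indexK.
have BM a j k l : row (mxtens_index (a, j)) B *m e k l =
    (j == k)%:R *: row a (b *m e ord0 l).
  rewrite BE -!row_mul bM; case: (j == k); last by rewrite mulr0n row0 scale0r.
  by rewrite mulr1n scale1r.
exists B; split.
(* Right multiplication by e_(k0) sends b_a e_(0k) to b_a and kills b_a e_(0j) for j != k. A linear
   relation among the rows of [B] thus gives, for each k, one among the independent b_a. *)
- apply: inj_row_free => w wB0.
  pose G k : 'M[F]_(\rank X * p, \rank X) :=
    \matrix_(t, a) (t == mxtens_index (a, k))%:R.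
  have Gij k a j a' : G k (mxtens_index (a, j)) a' = ((a, j) == (a', k))%:R.
    by rewrite mxE (can_eq (@mxtens_indexK _ _)).
  have GE k : B *m e k ord0 = G k *m b.
    apply/row_matrixP => t; case: (mxtens_indexP t) => a j.
    rewrite row_mul BM b1; apply/rowP => y.
    rewrite mxE [row a b _ _]mxE [RHS]mxE [RHS]mxE (bigD1 a)//= big1 => [|a' aa'].
      by rewrite addr0 Gij xpair_eqE eqxx.
    by rewrite Gij xpair_eqE eq_sym (negbTE aa') mul0r.
  apply/rowP => t; case: (mxtens_indexP t) => a k; rewrite mxE.
  have : w *m G k = 0.
    apply: (row_free_inj (row_base_free X)).
    by rewrite -mulmxA -GE mulmxA wB0 !mul0mx.
  move/rowP/(_ a); rewrite !mxE (bigD1 (mxtens_index (a, k)))//= big1 => [|t' tt'].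
    by rewrite !mxE eqxx mulr1 addr0.
  by rewrite mxE (negbTE tt') mulr0.
(* [V] is the sum of the V e_(ii) = V e_(i0) e_(0i), whose rows lie in the row space of [B]. Hence
   [\rank V <= \rank X * p]. *)
- rewrite leq_subLR; apply: leq_trans VD _; rewrite leq_add2r.
  apply: leq_trans (_ : \rank B <= _)%N; last exact: rank_leq_row.
  apply: mxrankS; rewrite -V1 summx_sub// => i _.
  have -> : V *m e i i = V *m e i ord0 *m e ord0 i by rewrite VM eqxx.
  apply: submx_trans (_ : b *m e ord0 i <= _)%MS.
    by apply: submxMr; rewrite eq_row_base (sumsmx_sup i).
  by apply/row_subP => a; rewrite row_mul -BE row_sub.
- by move=> k l a j; rewrite BM BE -row_mul.
Qed.

(** Let P be invertible with the rows of the exact module as its first r p rows. On these rows P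
    e_(kl) and S_(kl) P agree, so their difference has rank at most N - r p. *)
Lemma approx_units_std N (e : 'I_p -> 'I_p -> 'M[F]_N) :
  exists2 P : 'M[F]_N, P \in unitmx & forall k l,
    (\rank (P *m e k l *m invmx P - std_unit N k l)%R <= unit_defect e)%N.
Proof.
have [r [B [Bf rN BM]]] := exact_units e.
have [P Pu PB] := row_free_extend Bf; exists P => // k l.
apply: leq_trans rN.
have -> : P *m e k l *m invmx P - std_unit N k l =
          (P *m e k l - std_unit N k l *m P) *m invmx P.
  by rewrite mulmxBl mulmxK.
apply: leq_trans (mxrankM_maxl _ _) _; apply: mxrank_rows0 => x xr.
have rpN : (r * p <= N)%N by rewrite -(eqP Bf) rank_leq_col.
have xd : (x %/ p < N %/ p)%N.
  by rewrite (@leq_trans r)// ?ltn_divLR// leq_divRL.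
pose z := Ordinal (std_index_subproof l xd).
rewrite linearB/= (@std_unit_mulmx _ _ _ l _ x z)// row_mul.
have : val x = val (Ordinal xr) by [].
case: (mxtens_indexP (Ordinal xr)) => a j /= xE.
have xda : (x %/ p = a)%N by rewrite xE divnMDl// (divn_small (ltn_ord j)) addn0.
have xmj : (x %% p = j)%N by rewrite xE modnMDl (modn_small (ltn_ord j)).
rewrite (PB (mxtens_index (a, j)))// BM (PB (mxtens_index (a, l)) z)/= ?xda//.
by rewrite xmj val_eqE subrr.
Qed.

End Units.

End ApproximateMatrixUnits.

(** * Defect of a system of approximate matrix units in a metric algebra *)

Section MetricAlgebraTheory.
Variables (F : fieldType) (R : realType).
Implicit Types A B : metricAlgType F R.

Lemma mdist_sum A (I : Type) (r : seq I) (P : pred I) (f g : I -> A) :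
  mdist (\sum_(i <- r | P i) f i) (\sum_(i <- r | P i) g i)
    <= \sum_(i <- r | P i) mdist (f i) (g i) :> R.
Proof.
elim/big_rec3: _ => [|i x y z _ le_yx]; first by rewrite mdistxx.
by apply: le_trans (mdistD _ _ _ _) _; rewrite lerD2l.
Qed.

Lemma mdist_subr0 A (x y : A) : mdist x y = mdist (x - y) 0 :> R.
Proof. by rewrite -(mdistDr (- y)) subrr. Qed.

Lemma mdist_conj A (u v x y : A) : mdist (u * x * v) (u * y * v) <= mdist x y :> R.
Proof. exact: le_trans (mdistMr _ _ _) (mdistMl _ _ _). Qed.

Lemma mdist_conjC A (u v x y : A) : v * u = 1 ->
  mdist x (v * y * u) <= mdist (u * x * v) y :> R.
Proof.
move=> vu; have := mdist_conj v u (u * x * v) y.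
by rewrite !mulrA vu mul1r -!mulrA vu mulr1.
Qed.

Section MatrixUnits.
Variable n : nat.
Local Notation p := n.+1.
Implicit Types i j k l : 'I_p.

Definition mdefect A (a : 'I_p -> 'I_p -> A) : R :=
  \sum_(t : ('I_p * 'I_p) * ('I_p * 'I_p))
    mdist (a t.1.1 t.1.2 * a t.2.1 t.2.2) (a t.1.1 t.2.2 *+ (t.1.2 == t.2.1))
  + mdist (\sum_i a i i) 1.

(** Lipschitz constant of [mdefect]: if every entry moves by at most d, each of the p^4 product
    relations changes by at most 3 d (2 d from the product, d from the right-hand side) and the unit
    relation by at most p d. *)
Definition mdefect_lip : R := (3 * p ^ 4 + p)%N%:R.

Lemma mdefect_ge0 A (a : 'I_p -> 'I_p -> A) : 0 <= mdefect a.
Proof. by rewrite addr_ge0 ?sumr_ge0 ?mdist_ge0// => t _; rewrite mdist_ge0. Qed.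

Lemma mdefect_eq0 A (a : 'I_p -> 'I_p -> A) : mdefect a <= 0 ->
  (forall i j k l, a i j * a k l = a i l *+ (j == k)) /\ \sum_i a i i = 1.
Proof.
move=> a0; have {a0} : mdefect a == 0 by rewrite eq_le a0 mdefect_ge0.
rewrite paddr_eq0 ?sumr_ge0 ?mdist_ge0// => [|t _]; last by rewrite mdist_ge0.
rewrite psumr_eq0 => [|t _]; last by rewrite mdist_ge0.
move=> /andP[/allP H /eqP/mdist_positivity ->]; split=> // i j k l.
have /= /eqP := H ((i, j), (k, l)) (mem_index_enum _).
exact: mdist_positivity.
Qed.

Lemma mdefect_morph A B (f : {lrmorphism A -> B}) (a : 'I_p -> 'I_p -> A) :
    (forall x y, mdist (f x) (f y) = mdist x y :> R) ->
  mdefect (fun i j => f (a i j)) = mdefect a.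
Proof.
move=> fd; rewrite /mdefect -(rmorph1 f) -rmorph_sum fd; congr (_ + _).
by apply: eq_bigr => t _; rewrite -rmorphM -rmorphMn fd.
Qed.

Lemma mdefect_conj A (u v : A) (a : 'I_p -> 'I_p -> A) : u * v = 1 -> v * u = 1 ->
  mdefect (fun i j => u * a i j * v) <= mdefect a.
Proof.
move=> uv vu; rewrite /mdefect lerD ?ler_sum//.
  move=> t _; rewrite -mulrnAl -mulrnAr -mulrA [v * _]mulrA [v * (_ * _)]mulrA vu mul1r.
  by rewrite mulrA -[u * _ * _]mulrA; apply: mdist_conj.
rewrite -mulr_suml -mulr_sumr.
by have := mdist_conj u v (\sum_i a i i) 1; rewrite mulr1 uv.
Qed.

Lemma mdefect_close A (a b : 'I_p -> 'I_p -> A) (d : R) :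
    (forall i j, mdist (a i j) (b i j) <= d) ->
  mdefect a <= mdefect b + mdefect_lip * d.
Proof.
move=> abd.
have -> : mdefect b + mdefect_lip * d =
    \sum_(t : ('I_p * 'I_p) * ('I_p * 'I_p))
      (mdist (b t.1.1 t.1.2 * b t.2.1 t.2.2) (b t.1.1 t.2.2 *+ (t.1.2 == t.2.1))
        + d *+ 3)
    + (mdist (\sum_i b i i) 1 + \sum_(i < p) d).
  rewrite big_split/= !sumr_const !card_prod !card_ord /mdefect /mdefect_lip.
  rewrite -!mulrnA -[in RHS]mulr_natr -[d *+ p]mulr_natr natrD.
  rewrite (_ : (3 * (p * p * (p * p)) = 3 * p ^ 4)%N); first by ring.
  by rewrite /=; lia.
apply: lerD.
  apply: ler_sum => t _.
  set x := b t.1.1 _ * _; set y := b t.1.1 _ *+ _.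
  apply: le_trans (metric_triangle _ x _) _.
  have h1 : mdist (a t.1.1 t.1.2 * a t.2.1 t.2.2) x <= d + d :> R.
    by apply: le_trans (mdistM _ _ _ _) _; apply: lerD.
  have h2 : mdist y (a t.1.1 t.2.2 *+ (t.1.2 == t.2.1)) <= d :> R.
    rewrite /y; case: eqP => _; first by rewrite !mulr1n metric_sym.
    by rewrite !mulr0n mdistxx (le_trans _ (abd t.1.1 t.2.2)) ?mdist_ge0.
  have := metric_triangle x y (a t.1.1 t.2.2 *+ (t.1.2 == t.2.1)).
  lra.
apply: le_trans (metric_triangle _ (\sum_i b i i) _) _.
rewrite addrC lerD2l; apply: le_trans (mdist_sum _ _ _ _) _.
by apply: ler_sum.
Qed.

End MatrixUnits.
End MetricAlgebraTheory.

(** * Approximate matrix units in the direct limit *)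

Section DirectLimitUnits.
Variables (F : fieldType) (R : realType) (s : factorSeq) (n : nat).
Local Notation p := n.+1.
Local Notation L := (dlim F R s).
Local Notation dlin := (@Defs.dlin F R s _).

Lemma dlin0 k : dlin (0 : 'M[F]_(s k)) = 0.
Proof. by rewrite -[RHS]/(dl_zero F R s) (dl_zeroE F R s k). Qed.

Lemma dlinMn k (x : 'M[F]_(s k)) c : dlin (x *+ c) = dlin x *+ c.
Proof. by elim: c => [|c IH]; rewrite ?mulr0n ?dlin0// !mulrS dlinD IH. Qed.

Lemma dlin_sum k (I : Type) (r : seq I) (P : pred I) (f : I -> 'M[F]_(s k)) :
  dlin (\sum_(i <- r | P i) f i) = \sum_(i <- r | P i) dlin (f i).
Proof. exact: (big_morph _ (@dlinD F R s k) (dlin0 k)). Qed.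

Lemma mdefect_dlin k (e : 'I_p -> 'I_p -> 'M[F]_(s k)) :
  mdefect (fun i j => dlin (e i j)) = (unit_defect e)%:R / (s k)%:R.
Proof.
rewrite /mdefect /unit_defect -dlin_sum -(dlin1 F R s k) mdist_dlin natrD mulrDl.
congr (_ + _); rewrite natr_sum mulr_suml; apply: eq_bigr => t _.
by rewrite -dlinM -dlinMn mdist_dlin.
Qed.

Lemma mdefect_std_unit m :
  mdefect (fun i j : 'I_p => dlin (std_unit F (s m) i j)) <= p%:R / (s m)%:R.
Proof.
rewrite mdefect_dlin ler_wpM2r ?invr_ge0// ler_nat /unit_defect big1 => [|t _].
  exact: rank_sum_std_unit.
by rewrite std_unitM subrr mxrank0.
Qed.

(** From some level on all a_(ij) are matrices of size [s m], and rank stability applies there.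
    Having every later [m] available lets two systems be compared with the same standard one. *)
Lemma near_std_unit (a : 'I_p -> 'I_p -> L) : exists m0, forall m, (m0 <= m)%N ->
  exists u v : L, [/\ u * v = 1, v * u = 1 & forall i j,
    mdist (u * a i j * v) (dlin (std_unit F (s m) i j)) <= mdefect a].
Proof.
exists (\max_(t : 'I_p * 'I_p) tag (repr (a t.1 t.2))) => m /bigmax_leqP m0m.
pose e i j := at_level m (repr (a i j)).
have ae i j : a i j = dlin (e i j).
  by rewrite dlin_at//; apply: (m0m (i, j)).
have [P Pu PS] := approx_units_std e.
exists (dlin P), (dlin (invmx P)); split=> [||i j].
- by rewrite -dlinM mulmxV// dlin1.
- by rewrite -dlinM mulVmx// dlin1.
have -> : mdefect a = mdefect (fun i j => dlin (e i j)).
  by congr mdefect; apply/funext => ?; apply/funext => ?.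
rewrite mdefect_dlin ae -!dlinM mdist_dlin.
by rewrite ler_wpM2r ?invr_ge0// ler_nat.
Qed.

(** At a common level both systems are conjugate to approximately the same standard system; one
    conjugation is followed by the inverse of the other. *)
Lemma conj_close (a b : 'I_p -> 'I_p -> L) : exists u v : L,
  [/\ u * v = 1, v * u = 1
    & forall i j, mdist (u * a i j * v) (b i j) <= mdefect a + mdefect b].
Proof.
have [ma Ha] := near_std_unit a; have [mb Hb] := near_std_unit b.
have [ua [va [uva vua Ea]]] := Ha _ (leq_maxl ma mb).
have [ub [vb [uvb vub Eb]]] := Hb _ (leq_maxr ma mb).
exists (vb * ua), (va * ub); split=> [||i j].
- by rewrite mulrA -[vb * _ * _]mulrA uva mulr1.
- by rewrite mulrA -[va * _ * _]mulrA uvb mulr1.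
set S := dlin (std_unit F (s (maxn ma mb)) i j) in Ea Eb.
apply: le_trans (metric_triangle _ (vb * S * ub) _) _.
apply: lerD.
  have -> : vb * ua * a i j * (va * ub) = vb * (ua * a i j * va) * ub.
    by rewrite !mulrA.
  exact: le_trans (mdist_conj _ _ _ _) (Ea i j).
by rewrite metric_sym (le_trans (mdist_conjC _ _ _) (Eb i j)).
Qed.

(** The standard system of a deep level, conjugated back towards [a], stays within the defect of
    [a], while its own defect is at most p / s_m. *)
Lemma improve_units (a : 'I_p -> 'I_p -> L) (d : R) : 0 < d ->
  exists b : 'I_p -> 'I_p -> L,
    (forall i j, mdist (a i j) (b i j) <= mdefect a) /\ mdefect b <= d.
Proof.
move=> d0; have [m0 H] := near_std_unit a.
(* From level [N] on, [s m] exceeds p / d, so p / s_m < d. *)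
have [N _ HN] := (cvgnyPge s).1 (fseq_cvg s) (Num.truncn (p%:R / d)).+1.
have [u [v [uv vu E]]] := H _ (leq_maxl m0 N).
exists (fun i j => v * dlin (std_unit F (s (maxn m0 N)) i j) * u); split.
  by move=> i j; apply: le_trans (mdist_conjC _ _ _) (E i j).
apply: le_trans (mdefect_conj _ vu uv) _.
apply: le_trans (mdefect_std_unit _) _.
have sN := HN (maxn m0 N) (leq_maxr m0 N).
rewrite ler_pdivrMr ?ltr0n ?fseq_gt0// mulrC -ler_pdivrMr// ltW//.
by apply: lt_le_trans (truncnS_gt _) _; rewrite ler_nat.
Qed.

End DirectLimitUnits.

(** * Limits of geometrically converging sequences *)

Section GeometricCauchy.
Variables (F : fieldType) (R : realType) (A : metricAlgType F R).
Local Notation h := (2^-1 : R).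

Lemma geometric_dist (u : nat -> A) :
    (forall k, mdist (u k) (u k.+1) <= h ^+ k) ->
  forall k m, (k <= m)%N -> mdist (u k) (u m) <= 2 * h ^+ k.
Proof.
move=> uh k m /subnKC <-; move: (m - k)%N => d.
have h0 i : 0 <= h ^+ i by rewrite exprn_ge0// invr_ge0.
(* The sharper telescoped bound is what induction on d can carry: h^(k+d) = 2 h^(k+d) - 2
   h^(k+d+1). *)
suff : mdist (u k) (u (k + d)%N) <= 2 * h ^+ k - 2 * h ^+ (k + d).
  by move=> H; apply: (le_trans H); rewrite gerBl mulr_ge0.
elim: d => [|d IH]; first by rewrite addn0 mdistxx subrr.
rewrite addnS.
apply: le_trans (metric_triangle _ (u (k + d)%N) _) _.
apply: le_trans (lerD IH (uh _)) _.
rewrite (exprS _ (k + d)) mulrA divff ?pnatr_eq0// mul1r.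
by rewrite -addrA lerD2l; lra.
Qed.

Lemma expr_half_lt (e : R) : 0 < e -> exists k, 2 * h ^+ k < e.
Proof.
move=> e0; have /cvgr0Pnorm_lt/(_ (e / 2)) : (h ^+ k) @[k --> \oo] --> (0 : R).
  by apply: cvg_expr; rewrite ger0_norm ?invr_ge0// invf_lt1// ltr1n.
rewrite divr_gt0// => /(_ isT)[N _ HN]; exists N.
have := HN N (leqnn N); rewrite /= ger0_norm ?exprn_ge0 ?invr_ge0//.
by lra.
Qed.

Lemma geometric_limit (u : nat -> A) :
    (forall k, mdist (u k) (u k.+1) <= h ^+ k) ->
  exists c : completion A, forall k, mdist c (c_incl (u k)) <= 2 * h ^+ k.
Proof.
move=> uh; have cu : cauchy_seq u.
  apply/cauchy_seqP => e e0; have [N HN] := expr_half_lt (divr_gt0 e0 (ltr0Sn R 1)).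
  exists N => i j Ni Nj; apply: le_lt_trans (metric_triangle _ (u N) _) _.
  rewrite [e]splitr metric_sym ltrD// (le_lt_trans (geometric_dist uh _))//.
exists (cpi (mkS cu)) => k.
apply: (ler_cvg_to (@mdist_cpi F R A (mkS cu) (cs_cst (u k)))
    (cvg_cst (2 * h ^+ k))).
by exists k => // j /= kj; rewrite /cs_dist /= metric_sym; apply: geometric_dist.
Qed.

End GeometricCauchy.

(** * Unital homomorphisms from systems of matrix units *)

Section UnitalHom.
Variables (F : fieldType) (R : realType) (A : metricAlgType F R) (n : nat).
Local Notation p := n.+1.
Implicit Types i j k l : 'I_p.

Lemma matrix_units_lrmorphism (c : 'I_p -> 'I_p -> A) :
    (forall i j k l, c i j * c k l = c i l *+ (j == k)) -> \sum_i c i i = 1 ->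
  inhabited {lrmorphism rkmx F R n -> A}.
Proof.
move=> cM c1; pose f (x : rkmx F R n) : A := \sum_i \sum_j (x : 'M[F]_p) i j *: c i j.
have fl : linear f.
  move=> a x y; rewrite /f scaler_sumr -big_split; apply: eq_bigr => i _.
  rewrite scaler_sumr -big_split; apply: eq_bigr => j _.
  by rewrite !mxE scalerDl scalerA.
have fm : monoid_morphism f.
  split=> [|x y].
    rewrite -c1; apply: eq_bigr => i _; rewrite (bigD1 i)//= big1 => [|j ji].
      by rewrite mxE eqxx scale1r addr0.
    by rewrite mxE eq_sym (negbTE ji) scale0r.
  rewrite /f mulr_suml; apply: eq_bigr => i _.
  transitivity (\sum_k \sum_j ((x : 'M[F]_p) i k * (y : 'M[F]_p) k j) *: c i j).
    rewrite exchange_big; apply: eq_bigr => j _.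
    by rewrite [(x * y) _ _]mxE scaler_suml.
  rewrite mulr_suml; apply: eq_bigr => k _.
  (* Since c_(ik) c_(lj) = 0 for l != k, only the term l = k survives. *)
  rewrite mulr_sumr [RHS](bigD1 k)//= [X in _ + X]big1 => [|l lk].
    rewrite addr0 mulr_sumr; apply: eq_bigr => j _.
    by rewrite -scalerAl -scalerAr scalerA cM eqxx mulr1n.
  rewrite mulr_sumr big1// => j _.
  by rewrite -scalerAl -scalerAr cM eq_sym (negbTE lk) mulr0n !scaler0.
pose L := GRing.isLinear.Build F (rkmx F R n) A *:%R f fl.
pose M := GRing.isMonoidMorphism.Build (rkmx F R n) A f fm.
exact: inhabits (HB.pack_for {lrmorphism rkmx F R n -> A} f L M).
Qed.

Lemma lrmorphism_delta (f : {lrmorphism rkmx F R n -> A}) (x : rkmx F R n) :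
  f x = \sum_i \sum_j (x : 'M[F]_p) i j *: f (delta_mx i j).
Proof.
rewrite [in LHS](matrix_sum_delta x) linear_sum; apply: eq_bigr => i _.
by rewrite linear_sum; apply: eq_bigr => j _; rewrite linearZ.
Qed.

Lemma mdefect_delta (f : {lrmorphism rkmx F R n -> A}) :
  mdefect (fun i j => f (delta_mx i j)) = 0.
Proof.
rewrite /mdefect big1 => [|t _]; last first.
  rewrite -rmorphM [_ * _]mul_delta_mx_cond -rmorphMn mdistxx//.
rewrite -rmorph_sum add0r -(rmorph1 f) (_ : \sum_i _ = 1) ?mdistxx//.
apply/matrixP => x y; rewrite summxE (bigD1 x)//= big1 => [|i ix].
  by rewrite !mxE eqxx eq_sym addr0.
by rewrite mxE eq_sym (negbTE ix).
Qed.

End UnitalHom.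

(** * Inner automorphisms *)

Section Conjugation.
Variables (F : fieldType) (R : realType) (A : metricAlgType F R).

(** Conjugation is isometric because it and the inverse conjugation are both contractions. *)
Lemma conj_automorphism (u v : A) : u * v = 1 -> v * u = 1 ->
  exists b : automorphism A, forall x, b x = u * x * v.
Proof.
move=> uv vu; pose f (x : A) := u * x * v.
have fl : linear f by move=> a x y; rewrite /f mulrDr mulrDl -scalerAr -scalerAl.
have fm : monoid_morphism f.
  by split=> [|x y]; rewrite /f ?mulr1// -!mulrA [v * _]mulrA vu mul1r.
pose L := GRing.isLinear.Build F A A *:%R f fl.
pose M := GRing.isMonoidMorphism.Build A A f fm.
pose g := HB.pack_for {lrmorphism A -> A} f L M.
have gd x y : mdist (g x) (g y) = mdist x y :> R.
  apply/eqP; rewrite eq_le mdist_conj/=.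
  have := mdist_conj v u (g x) (g y).
  by rewrite /g/= /f !mulrA vu !mul1r -!mulrA vu !mulr1.
have gs y : exists x, g x = y.
  by exists (v * y * u); rewrite /g/= /f !mulrA uv mul1r -mulrA uv mulr1.
by exists (Automorphism (automorphism_embedding := Embedding gd) gs).
Qed.

End Conjugation.

(** * Rank function, universality and homogeneity of the limit algebra *)

Section LimitAlgebra.
Variables (F : fieldType) (R : realType) (s : factorSeq).
Local Notation L := (dlim F R s).
Local Notation M := (limit_algebra F R s).

(** The distance to 0 is the normalized rank, so this is the Frobenius rank inequality at a common
    level, divided by the size. *)
Lemma dlim_frobenius (a b c : L) :
  mdist (a * b) 0 + mdist (b * c) 0 <= mdist b 0 + mdist (a * b * c) 0 :> R.
Proof.
move: a b c; apply: dlinW3 => m x y z.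
rewrite -(dlin0 F R s m) -!dlinM !mdist_dlin /rkdist !subr0 -!mulrDl.
by rewrite ler_wpM2r ?invr_ge0// -!natrD ler_nat mxrank_Frobenius.
Qed.

Lemma limit_frobenius (a b c : M) :
  mdist (a * b) 0 + mdist (b * c) 0 <= mdist b 0 + mdist (a * b * c) 0 :> R.
Proof.
elim/cpiW: a => a; elim/cpiW: b => b; elim/cpiW: c => c.
have H w : cs_dist w (cs_cst 0) @ \oo --> (mdist (cpi w : M) 0 : R).
  exact: mdist_cpi.
rewrite -![_ * _]/(c_mul _ _) !c_mulE.
apply: (ler_cvg_to (cvgD (H _) (H _)) (cvgD (H _) (H _))).
by apply: nearW => i; apply: dlim_frobenius.
Qed.

Lemma limit_mdist10 : mdist (1 : M) 0 = 1 :> R.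
Proof.
rewrite -[1]/(c_incl (1 : L)) -[0]/(c_incl (0 : L)) mdist_incl.
rewrite -(dlin0 F R s 0) -(dlin1 F R s 0) mdist_dlin /rkdist subr0 mxrank1.
by rewrite divff// pnatr_eq0 -lt0n fseq_gt0.
Qed.

Section Isometry.
Variables (n : nat) (f : {lrmorphism rkmx F R n -> M}).
Local Notation p := n.+1.
Local Notation rho x := (mdist (f (x : 'M[F]_p)) 0 : R).

Lemma rhoM_le (x y : 'M[F]_p) : rho (x *m y) <= rho x /\ rho (x *m y) <= rho y.
Proof.
rewrite [f _](rmorphM f); split.
  by have := mdistMr (f y) (f x) 0; rewrite mul0r.
by have := mdistMl (f x) (f y) 0; rewrite mulr0.
Qed.

Lemma rho_unit (x y z : 'M[F]_p) : x \in unitmx -> z \in unitmx ->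
  rho (x *m y *m z) = rho y.
Proof.
move=> ux uz; apply/eqP; rewrite eq_le; apply/andP; split.
  by apply: le_trans (rhoM_le _ _).1 _; apply: (rhoM_le _ _).2.
have {1}-> : y = invmx x *m (x *m y *m z) *m invmx z.
  by rewrite !mulmxA mulVmx// mul1mx mulmxK.
by apply: le_trans (rhoM_le _ _).1 _; apply: (rhoM_le _ _).2.
Qed.

Lemma rho_delta (i : 'I_p) :
  rho (delta_mx i i) = rho (delta_mx ord0 ord0).
Proof.
have le j k : rho (delta_mx j j) <= rho (delta_mx k k).
  have := (rhoM_le (delta_mx j k) (delta_mx k j)).2.
  have := (rhoM_le (delta_mx k k) (delta_mx k j)).1.
  by rewrite !mul_delta_mx => h1 h2; apply: le_trans h2 h1.
by apply/eqP; rewrite eq_le !le.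
Qed.

(** One inequality is subadditivity. The other is Frobenius for the triple x, x + y, y, since x (x +
    y) = x, (x + y) y = y and x (x + y) y = 0. *)
Lemma rhoD_orthogonal (x y : 'M[F]_p) : x *m x = x -> y *m y = y ->
  x *m y = 0 -> y *m x = 0 -> rho (x + y) = rho x + rho y.
Proof.
move=> xx yy xy yx; apply/eqP; rewrite eq_le; apply/andP; split.
  rewrite [f _](rmorphD f) -[X in mdist _ X]addr0; exact: mdistD.
have := limit_frobenius (f (x : rkmx F R n)) (f (x + y : 'M[F]_p)) (f (y : rkmx F R n)).
have xE : (x : rkmx F R n) * (x + y : 'M[F]_p) = x.
  by rewrite [LHS]mulmxDr xx xy addr0.
have yE : (x + y : 'M[F]_p) * (y : rkmx F R n) = y.
  by rewrite [LHS]mulmxDl xy yy add0r.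
by rewrite -!(rmorphM f) xE yE [x * y]xy rmorph0 mdistxx addr0.
Qed.

Lemma rho_pid r : (r <= p)%N -> rho (pid_mx r) = r%:R * rho (delta_mx ord0 ord0).
Proof.
elim: r => [|r IH] rp; first by rewrite pid_mx_0 rmorph0 mdistxx mul0r.
pose k := Ordinal rp.
have pE : pid_mx r.+1 = pid_mx r + delta_mx k k :> 'M[F]_p.
  apply/matrixP => x y; rewrite !mxE -!val_eqE/= ltnS leq_eqVlt.
  case: (eqVneq (x : nat) r) => [->|xr]; last by rewrite addr0.
  by rewrite ltnn andbF orbF andbT add0r eq_sym.
have pk : pid_mx r *m delta_mx k k = 0 :> 'M[F]_p.
  apply/matrixP => x y; rewrite !mxE big1// => z _; rewrite !mxE -!val_eqE/=.
  case: (eqVneq (x : nat) z) => [->|_]; last by rewrite mul0r.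
  by case: (eqVneq (z : nat) r) => [->|_]; rewrite ?ltnn ?mul0r ?mulr0.
have kp : delta_mx k k *m pid_mx r = 0 :> 'M[F]_p.
  by rewrite -[LHS]trmxK trmx_mul trmx_delta tr_pid_mx pk trmx0.
rewrite pE rhoD_orthogonal ?mul_delta_mx ?mul_pid_mx ?minnn ?(minn_idPr (ltnW rp))//.
by rewrite IH ?(ltnW rp)// rho_delta -natr1 mulrDl mul1r.
Qed.

(** Up to invertible factors x is a sum of [\rank x] orthogonal diagonal units, all of the same
    [rho]. The case x = 1 shows that this common value is 1 / p. *)
Lemma rho_rank (x : 'M[F]_p) : rho x = (\rank x)%:R / p%:R.
Proof.
have c1 : p%:R * rho (delta_mx ord0 ord0) = 1.
  by rewrite -rho_pid// pid_mx_1 -limit_mdist10 -[in RHS](rmorph1 f).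
rewrite -(mulmx_ebase x) rho_unit ?col_ebase_unit ?row_ebase_unit//.
rewrite rho_pid ?rank_leq_row// mulmx_ebase; congr (_ * _).
have p0 : p%:R != 0 :> R by rewrite pnatr_eq0.
by apply: (mulfI p0); rewrite c1 divff.
Qed.

Lemma lrmorphism_isometry (x y : rkmx F R n) : mdist (f x) (f y) = mdist x y :> R.
Proof. by rewrite mdist_subr0 -rmorphB rho_rank. Qed.

End Isometry.

Lemma limit_universal n : inhabited (embedding (rkmx F R n) M).
Proof.
have /choice[f Hf] (ka : nat * ('I_n.+1 -> 'I_n.+1 -> L)) :
    exists b : 'I_n.+1 -> 'I_n.+1 -> L,
      (forall i j, mdist (ka.2 i j) (b i j) <= mdefect ka.2) /\
      mdefect b <= 2^-1 ^+ ka.1.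
  by apply: improve_units; rewrite exprn_gt0 ?invr_gt0.
(* Starting from an improvement of the zero system, each [a k.+1] improves [a k] to defect at most
   2^-(k+1). The distance moved is at most the defect of [a k], hence at most 2^-k. *)
pose a := fix a k := if k is k'.+1 then f (k, a k') else f (0%N, fun _ _ => 0).
have da k : mdefect (a k) <= 2^-1 ^+ k by case: k => [|k]; exact: (Hf (_, _)).2.
have /choice[c Hc] (ij : 'I_n.+1 * 'I_n.+1) : exists c : M,
    forall k, mdist c (c_incl (a k ij.1 ij.2)) <= 2 * 2^-1 ^+ k.
  apply: geometric_limit => k.
  by apply: le_trans ((Hf (k.+1, a k)).1 _ _) (da k).
have [cM c1] : (forall i j k l, c (i, j) * c (k, l) = c (i, l) *+ (j == k)) /\
    \sum_i c (i, i) = 1.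
  apply: (@mdefect_eq0 F R n M (fun i j => c (i, j))).
  (* With K the Lipschitz constant, the limit has defect at most 2^-k + 2 K 2^-k <= 2 (K + 1) 2^-k
     for every k, which explains the factor K + 1. *)
  apply/ler_addgt0Pr => e e0; rewrite add0r.
  have K0 : 0 < mdefect_lip R n + 1 by rewrite ltr_wpDl ?ler0n.
  have [k Hk] := expr_half_lt (divr_gt0 e0 K0).
  apply: le_trans (mdefect_close (b := fun i j => c_incl (a k i j))
    (d := 2 * 2^-1 ^+ k) _) _.
    by move=> i j; apply: (Hc (i, j)).
  rewrite (mdefect_morph (f := @c_incl F R L)); last exact: mdist_incl.
  have := da k; rewrite ltr_pdivlMr// in Hk; have : 0 <= 2^-1 ^+ k :> R.
    by rewrite exprn_ge0// invr_ge0.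
  nra.
have [g] := matrix_units_lrmorphism cM c1.
exact: inhabits (Embedding (lrmorphism_isometry g)).
Qed.

Lemma limit_homogeneous n (phi psi : embedding (rkmx F R n) M) (eps : R) :
  0 < eps -> exists beta : automorphism M,
    forall x, mdist (beta (phi x)) (psi x) <= eps.
Proof.
move=> eps0; pose K := mdefect_lip R n; pose q : R := n.+1%:R.
have K0 : 0 <= K by rewrite ler0n.
have q0 : 0 < q by rewrite ltr0n.
(* Each matrix unit contributes an error of (2 + 2 K) d: d for each of the two approximations and K
   d for each of the two defects. There are q^2 matrix units. *)
pose d := eps / (q * q * (2 + 2 * K)).
have d0 : 0 < d by rewrite divr_gt0// !mulr_gt0//; lra.
have approx (f : embedding (rkmx F R n) M) : exists a : 'I_n.+1 -> 'I_n.+1 -> L,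
    (forall i j, mdist (c_incl (a i j)) (f (delta_mx i j)) <= d) /\
    mdefect a <= K * d.
  have /choice[a Ha] (ij : 'I_n.+1 * 'I_n.+1) : exists a : L,
    mdist (c_incl a) (f (delta_mx ij.1 ij.2)) < d by exact: c_incl_dense.
  exists (fun i j => a (i, j)).
  have aE i j : mdist (c_incl (a (i, j))) (f (delta_mx i j)) <= d.
    exact: ltW (Ha (i, j)).
  split=> //; rewrite -(mdefect_morph (f := @c_incl F R L)); last exact: mdist_incl.
  by apply: le_trans (mdefect_close aE) _; rewrite mdefect_delta add0r.
have [a [aphi aK]] := approx phi; have [b [bpsi bK]] := approx psi.
have [u [v [uv vu Huv]]] := conj_close a b.
have UV : (c_incl u : M) * c_incl v = 1 by rewrite -rmorphM uv rmorph1.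
have VU : (c_incl v : M) * c_incl u = 1 by rewrite -rmorphM vu rmorph1.
have [beta Hb] := conj_automorphism UV VU; exists beta => x.
have ij_close i j :
    mdist (beta (phi (delta_mx i j))) (psi (delta_mx i j)) <= (2 + 2 * K) * d.
  rewrite Hb.
  have h1 := mdist_conj (c_incl u : M) (c_incl v) (phi (delta_mx i j)) (c_incl (a i j)).
  have h2 := Huv i j; rewrite -(mdist_incl (u * a i j * v)) !rmorphM in h2.
  have h3 := metric_triangle (c_incl u * phi (delta_mx i j) * c_incl v)
    (c_incl u * c_incl (a i j) * c_incl v) (psi (delta_mx i j)).
  have h4 := metric_triangle (c_incl u * c_incl (a i j) * c_incl v)
    (c_incl (b i j)) (psi (delta_mx i j)).
  have h5 := aphi i j; rewrite metric_sym in h5; have h6 := bpsi i j.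
  lra.
(* The estimate is uniform in x because multiplication by the scalar entries of x is contractive. *)
rewrite (lrmorphism_delta phi) (lrmorphism_delta psi) linear_sum.
apply: le_trans (mdist_sum _ _ _ _) _.
apply: le_trans (_ : \sum_(i < n.+1) \sum_(j < n.+1) (2 + 2 * K) * d <= _).
  apply: ler_sum => i _; rewrite linear_sum.
  apply: le_trans (mdist_sum _ _ _ _) _; apply: ler_sum => j _.
  by rewrite linearZ; apply: le_trans (mdistZ _ _ _) (ij_close i j).
rewrite !sumr_const !card_ord -!mulrnA -[_ *+ (_ * _)]mulr_natr natrM -/q /d.
rewrite le_eqVlt; apply/orP; left; apply/eqP; field.
by rewrite !gt_eqF//=; lra.
Qed.

End LimitAlgebra.

Theorem mainTheorem2 (R : realType) (F : finFieldType) (s : factorSeq) :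
  [/\ K_structure (limit_algebra F R s),
      forall n : nat,
        inhabited (embedding (rkmx F R n) (limit_algebra F R s))
    & forall (n : nat)
        (phi psi : embedding (rkmx F R n) (limit_algebra F R s)) (eps : R),
        0 < eps ->
        exists beta : automorphism (limit_algebra F R s),
          (map_dist (beta \o phi) psi < eps%:E)%E].
Proof.
split=> [|n|n phi psi eps eps0]; first 2 last.
(* A supremum of distances inherits only a weak bound; eps / 2 makes it strict. *)
- have [beta Hb] := limit_homogeneous phi psi (divr_gt0 eps0 (ltr0Sn R 1)).
  exists beta; apply: (@le_lt_trans _ _ (eps / 2)%:E).
    by apply: ge_ereal_sup => _ [x _ <-]; rewrite lee_fin; apply: Hb.
  by rewrite lte_fin; lra.
(* Conjugation by 1 provides the surjective embedding of the limit algebra onto itself. *)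
- exists s; have one11 : (1 : limit_algebra F R s) * 1 = 1 by rewrite mulr1.
  by have [b _] := conj_automorphism one11 one11; exists b; apply: automorphism_surj.
- exact: limit_universal.
Qed.
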